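(* Let $M\subseteq\mathbb{R}_+=[0,\infty)$ be a set such that: (1) $|M|\le\omega_1$; (2) for every $r\in M$ the set $M_r=M\cap\mathbb{Q}r$ is a floppy monoid; (3) for every subset $B\subseteq M$ of cardinality $|B|<|M|$, the set $\ddot M\setminus(\mathbb{Q}B+\mathbb{Q}B)$ is dense in $\mathbb{R}_+$. Then there exists a Banakh space $(X,d)$ with $d[X^2]=M$.
   Context: For a metric space $(X,d)$, $d[X^2]=\{d(x,y):x,y\in X\}$ and $\mathsf{S}(c;r)=\{x\in X:d(x,c)=r\}$. A metric space $(X,d)$ is a Banakh space if for every $c\in X$ and every $r\in d[X^2]$ there exist points $x,y\in X$ such that $\mathsf{S}(c;r)=\{x,y\}$ and $d(x,y)=2r$. For subsets of $\mathbb{R}$: $\mathbb{Q}r=\{qr:q\in\mathbb{Q}\}$, $\mathbb{Q}B=\{qb:q\in\mathbb{Q},\,b\in B\}$, and $A+C=\{a+c:a\in A,\,c\in C\}$. A set $N\subseteq\mathbb{R}$ is a monoid if $0\in N=N+N$. A set $N\subseteq\mathbb{R}$ is floppy if every real number $r$ satisfying $r=\inf\{a+b:a,b\in N,\ r=b-a\}$ belongs to $N$ (with $\inf\emptyset=+\infty$). For $M\subseteq[0,\infty)$, $$\ddot M=\{r\in M\setminus\{0\}:\ x+y\ne r\ \text{ for all } x,y\in(M\cap\mathbb{Q}r)\setminus\{0,r\}\}.$$ $\omega_1$ is the first uncountable cardinal. *)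

(* Defs.v *)
From HB Require Import structures.
From mathcomp Require Import all_boot all_order all_algebra.
From mathcomp Require Import all_classical all_reals all_analysis.
From mathcomp Require wochoice.
Import Order.TTheory GRing.Theory Num.Theory.
Import numFieldNormedType.Exports.
Set Implicit Arguments.
Unset Strict Implicit.
Unset Printing Implicit Defensive.
Local Open Scope classical_set_scope.
Local Open Scope ring_scope.
Local Open Scope card_scope.

Definition card_lt (T U : Type) (A : set T) (B : set U) : Prop :=
  A #<= B /\ ~ (B #<= A).

Definition is_omega1 (T : Type) (W : set T) : Prop :=
  ~ countable W /\
  forall (U : Type) (B : set U), ~ countable B -> W #<= B.

Lemma uncountable_set_nat : ~ countable [set: set nat].
Proof.
move=> /countable_injP[f f_inj].
pose D : set nat := [set n | exists2 A : set nat, f A = n & ~ A n].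
have nD : ~ D (f D).
  move=> /[dup] DfD [A fAD nA].
  have AD : A = D by apply: f_inj; rewrite ?inE.
  by apply: nA; rewrite AD.
by apply: (nD); exists D.
Qed.

Lemma omega1_exists : exists W : set (set nat), is_omega1 W.
Proof.
have [le le_wo] := wochoice.well_ordering_principle (set nat).
pose lt x y := ~~ le y x.
have min_ex (P : set (set nat)) : P !=set0 ->
    exists2 x, P x & forall y, lt y x -> ~ P y.
  move=> [p Pp]; have [|x [[/asboolP Px xmin] _]] := le_wo (fun x => `[< P x >]).
    by exists p; apply/asboolP.
  exists x => // y /negP ltyx Py; apply: ltyx.
  by apply: xmin; apply/asboolP.
have lt_wf : well_founded lt.
  move=> x; apply: contrapT => nx.
  have [y ny ymin] := min_ex [set z | ~ Acc lt z] (ex_intro _ x nx).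
  by apply: ny; split=> z /ymin /contrapT.
have [W Wunc Wseg] : exists2 W : set (set nat), ~ countable W &
    forall x, W x -> countable [set y | lt y x].
  have [[x xunc]|nunc] := pselect (exists x, ~ countable [set y | lt y x]).
    have [w wunc wmin] := min_ex [set z | ~ countable [set y | lt y z]]
      (ex_intro _ x xunc).
    by exists [set y | lt y w] => // z /wmin /contrapT.
  exists setT; first exact: uncountable_set_nat.
  by move=> x _; apply: contrapT => xunc; apply: nunc; exists x.
exists W; split=> // U B Bunc.
have [b0 Bb0] : B !=set0.
  by apply/set0P/eqP => B0; apply: Bunc; rewrite B0; apply: countable0.
pose F x (rec : forall y, lt y x -> U) : U :=
  xget (b0 : {classic U})
    (B `\` [set b | exists y (h : lt y x), b = rec y h]).
pose f := Fix lt_wf (fun _ => U) F.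
have fE x : f x = xget (b0 : {classic U}) (B `\` (f @` [set y | lt y x])).
  rewrite /f Fix_eq; last first.
    move=> z g1 g2 g12; congr F.
    by apply/functional_extensionality_dep => y; apply/funext.
  rewrite /F; suff -> : [set b | exists y (h : lt y x), b = f y] =
    f @` [set y | lt y x] by [].
  by apply/seteqP; split=> [b [y [h ->]]|b [y h <-]]; [exists y|exists y, h].
have fP x : W x -> (B `\` (f @` [set y | lt y x])) (f x).
  move=> Wx; rewrite fE; apply: xgetPex.
  apply: contrapT => noB; apply: Bunc.
  apply: (@sub_countable _ _ B (f @` [set y | lt y x])).
    by apply: subset_card_le => b Bb; apply: contrapT => nb; apply: noB; exists b.
  by apply: sub_countable (Wseg x Wx); apply: card_image_le.
suff : $|{injfun W >-> B}| by move=> [g]; apply: inj_card_le g.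
apply/injfunPex; exists f; first by move=> x /fP[].
move=> x y; rewrite !inE => Wx Wy fxy; apply: contrapT => nxy.
have [ltxy|nltxy] := boolP (lt x y).
  by have [_] := fP _ Wy; apply; exists x.
have [ltyx|nltyx] := boolP (lt y x).
  by have [_] := fP _ Wx; apply; exists y.
apply: nxy; apply: (wochoice.wo_chain_antisymmetric (C := predT) (wochoice.withinW le_wo)) => //.
by move: nltxy nltyx; rewrite /lt !negbK => -> ->.
Qed.

(* An arbitrary representative of the first uncountable cardinal; only its
   cardinality is meaningful, and omega1P determines it up to #=. *)
Definition omega1 : set (set nat) := sval (cid omega1_exists).

Lemma omega1P : is_omega1 omega1.
Proof. exact: svalP (cid omega1_exists). Qed.

Section banakh_space.
Variables (R : realType) (X : metricType R).

Definition distances : set R := [set mdist x y | x in [set: X] & y in [set: X]].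

Definition metric_sphere (c : X) (r : R) : set X := [set x | mdist x c = r].

Definition banakh_space : Prop :=
  forall (c : X) (r : R), distances r ->
    exists x y : X, metric_sphere c r = [set x; y] /\ mdist x y = 2 * r.

End banakh_space.

Section real_sets.
Variable R : realType.
Implicit Types (A B C M N : set R) (r : R).

Definition set_add A C : set R := [set a + c | a in A & c in C].

Definition rat_line r : set R := [set ratr q * r | q in [set: rat]].

Definition rat_scale B : set R := [set ratr q * b | q in [set: rat] & b in B].

Definition is_monoid N : Prop := N 0 /\ N = set_add N N.

(* The infimum is taken in the extended reals, so that inf set0 = +oo. *)
Definition floppy N : Prop :=
  forall r, r%:E = ereal_inf [set s | exists a b,
                     [/\ N a, N b, r = b - a & s = (a + b)%:E]] ->
    N r.

Definition ddot M : set R :=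
  [set r | (M `\ 0) r /\
    forall x y, ((M `&` rat_line r) `\` [set 0; r]) x ->
                ((M `&` rat_line r) `\` [set 0; r]) y -> x + y <> r].

End real_sets.

(* Main.v *)
(* The space is built by generic amalgamation inside a fixed uncountable set. An
   approximation ("frame") carries a metric [ub], an upper bound for the final
   distance, and a lower bound [lb] with [lb x z <= lb x y + ub y z]; a pair is
   decided when the two bounds agree. Any value strictly between the bounds can
   be prescribed at an undecided pair without deciding any other pair.

   For [b] in [M], with [M_b] the part of [M] commensurable with [b], the group
   [M_b - M_b] is a frame for [lb g h = |g - h|] and
   [ub g h = inf {a + c | a, c in M_b, c - a = g - h}]. Floppiness of [M_b] says
   exactly that only the pairs with [|g - h|] in [M_b] are decided, and for those
   distances every sphere consists of two antipodal points. When a pair [x, y]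
   has just received the distance [r], with [r] in [ddot M] and outside the
   rational span of the earlier distances, a fresh copy of the line of [r] is
   glued along [x = 0], [y = r]; the irreducibility of [r] prevents the gluing
   from deciding further pairs. Lines of classes already in use are glued at a
   single point, through every point that lacks one.

   After countably many steps every pair is decided. If [M] is countable this
   yields the space, starting from one point. Otherwise one iterates along a
   well-order of [M] with countable initial segments: only finitely many steps
   can narrow the interval of a pair before it is decided, and unions of decided
   spaces are decided, so each stage again starts from a countable space. *)
Require Import Defs.
From HB Require Import structures.
From mathcomp Require Import all_boot all_order all_algebra.
From mathcomp Require Import all_classical all_reals all_analysis.
From mathcomp Require Import lra.
From mathcomp Require wochoice.
Import Order.TTheory GRing.Theory Num.Theory.
Import numFieldNormedType.Exports.
Set Implicit Arguments.
Unset Strict Implicit.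
Unset Printing Implicit Defensive.
Local Open Scope classical_set_scope.
Local Open Scope ring_scope.

(** * Arithmetic of the gluing of two frames *)

Section glue_arithmetic.
Variables (R : realFieldType) (r : R).
Implicit Types a b c d l m p q : R.

Lemma min_cases a b : [/\ Num.min a b <= a, Num.min a b <= b &
  Num.min a b = a \/ Num.min a b = b].
Proof.
by case: (leP a b) => [ab|/ltW ab]; split=> //; (by left) || (by right).
Qed.

Lemma max_cases a b : [/\ a <= Num.max a b, b <= Num.max a b &
  Num.max a b = a \/ Num.max a b = b].
Proof.
by case: (leP a b) => [ab|/ltW ab]; split=> //; (by left) || (by right).
Qed.

(* [a, b] and [l, m] are the upper and lower bounds from a point to the two ends
   of the common decided pair, which is at distance [r]. *)
Definition vertex a b l m :=
  [/\ [/\ 0 <= a, 0 <= b, a <= b + r, b <= a + r & r <= a + b],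
      [/\ l <= a, m <= b, - a <= l & - b <= m] &
      [/\ l <= m + r, m <= l + r, r - b <= l & r - a <= m]].

(** The inequalities between two points of one frame, with mutual bounds [u] and [v], and the two
    ends. Unprimed numbers belong to the first point, primed ones to the second. *)
Definition side u v a b l m a' b' l' m' :=
  [/\ [/\ a <= u + a', a' <= u + a, b <= u + b' & b' <= u + b],
      [/\ u <= a + a', u <= b + b' & v <= u],
      [/\ v <= l + a', v <= l' + a, v <= m + b' & v <= m' + b],
      [/\ l <= v + a', l' <= v + a, m <= v + b' & m' <= v + b] &
      [/\ l <= l' + u, l' <= l + u, m <= m' + u & m' <= m + u]].

(** Points on different sides are joined by the shorter of the two routes through an end. *)
Definition glue_ub a b a' b' := Num.min (a + a') (b + b').
(** The least value compatible with [lb x z <= lb x y + ub y z] for [x], [y] on different sides, in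
    either order, and [z] an end. *)
Definition glue_lb a b l m a' b' l' m' :=
  Num.max (Num.max (l - a') (m - b')) (Num.max (l' - a) (m' - b)).

Lemma glue_ubP a b a' b' : [/\ glue_ub a b a' b' <= a + a',
  glue_ub a b a' b' <= b + b' &
  glue_ub a b a' b' = a + a' \/ glue_ub a b a' b' = b + b'].
Proof. exact: min_cases. Qed.

Lemma glue_lbP a b l m a' b' l' m' (v := glue_lb a b l m a' b' l' m') :
  [/\ l - a' <= v, m - b' <= v, l' - a <= v, m' - b <= v &
   [\/ v = l - a', v = m - b', v = l' - a | v = m' - b]].
Proof.
rewrite /v /glue_lb; have [] := max_cases (l - a') (m - b').
have [] := max_cases (l' - a) (m' - b).
set p := Num.max _ _; set q := Num.max _ _; have [] := max_cases q p.
move=> h1 h2 h3 h4 h5 h6 h7 h8 h9; split; try lra.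
case: h3 => ->; [case: h9|case: h6] => ->;
  by [constructor 1|constructor 2|constructor 3|constructor 4].
Qed.

Lemma glue_ubC a b a' b' : glue_ub a b a' b' = glue_ub a' b' a b.
Proof. by rewrite /glue_ub addrC [b + _]addrC. Qed.

Lemma glue_lbC a b l m a' b' l' m' :
  glue_lb a b l m a' b' l' m' = glue_lb a' b' l' m' a b l m.
Proof. by rewrite /glue_lb maxC. Qed.

(** A lower bound at one end meets the route through that end only if a point coincides with the
    end, and meets the route through the other end only if some point lies on a shortest path
    between the ends. The strict hypotheses exclude both. *)
Lemma glue_lt a b l m a' b' l' m' : vertex a b l m -> vertex a' b' l' m' ->
  0 < a -> 0 < b -> 0 < a' -> 0 < b' -> r < a + b -> r < a' + b' ->
  glue_lb a b l m a' b' l' m' < glue_ub a b a' b'.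
Proof.
move=> [[? ? ? ? ?] [? ? ? ?] [? ? ? ?]] [[? ? ? ? ?] [? ? ? ?] [? ? ? ?]].
move=> ? ? ? ? ? ?.
have [_ _ _ _] := glue_lbP a b l m a' b' l' m'; have [_ _] := glue_ubP a b a' b'.
by case=> -> []->; lra.
Qed.

Section triangles.
Variables u v a b l m a' b' l' m' c d p q : R.
Hypotheses (V : vertex a b l m) (V' : vertex a' b' l' m') (W : vertex c d p q).
Hypothesis S : side u v a b l m a' b' l' m'.

(** In this section [c], [d], [p], [q] belong to a third point on the other side. Once it is fixed
    which ends the routes use, each inequality is linear. *)
Lemma glue_ub_same : u <= glue_ub a b c d + glue_ub c d a' b'.
Proof.
move: V V' W S.
move=> [[? ? ? ? ?] [? ? ? ?] [? ? ? ?]] [[? ? ? ? ?] [? ? ? ?] [? ? ? ?]].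
move=> [[? ? ? ? ?] [? ? ? ?] [? ? ? ?]].
move=> [[? ? ? ?] [? ? ?] [? ? ? ?] [? ? ? ?] [? ? ? ?]].
have [_ _] := glue_ubP a b c d; have [_ _] := glue_ubP c d a' b'.
by case=> -> []->; lra.
Qed.

Lemma glue_ub_cross : glue_ub a b c d <= u + glue_ub a' b' c d.
Proof.
move: V V' W S.
move=> [[? ? ? ? ?] [? ? ? ?] [? ? ? ?]] [[? ? ? ? ?] [? ? ? ?] [? ? ? ?]].
move=> [[? ? ? ? ?] [? ? ? ?] [? ? ? ?]].
move=> [[? ? ? ?] [? ? ?] [? ? ? ?] [? ? ? ?] [? ? ? ?]].
have [? ? _] := glue_ubP a b c d; have [_ _] := glue_ubP a' b' c d.
by case=> ->; lra.
Qed.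

Lemma glue_lb_same : v <= glue_lb a b l m c d p q + glue_ub c d a' b'.
Proof.
move: V V' W S.
move=> [[? ? ? ? ?] [? ? ? ?] [? ? ? ?]] [[? ? ? ? ?] [? ? ? ?] [? ? ? ?]].
move=> [[? ? ? ? ?] [? ? ? ?] [? ? ? ?]].
move=> [[? ? ? ?] [? ? ?] [? ? ? ?] [? ? ? ?] [? ? ? ?]].
have [? ? ? ? _] := glue_lbP a b l m c d p q; have [_ _] := glue_ubP c d a' b'.
by case=> ->; lra.
Qed.

Lemma glue_lb_cross_lb : glue_lb a b l m c d p q <= v + glue_ub a' b' c d.
Proof.
move: V V' W S.
move=> [[? ? ? ? ?] [? ? ? ?] [? ? ? ?]] [[? ? ? ? ?] [? ? ? ?] [? ? ? ?]].
move=> [[? ? ? ? ?] [? ? ? ?] [? ? ? ?]].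
move=> [[? ? ? ?] [? ? ?] [? ? ? ?] [? ? ? ?] [? ? ? ?]].
have [_ _ _ _] := glue_lbP a b l m c d p q; have [_ _] := glue_ubP a' b' c d.
by case=> -> []->; lra.
Qed.

Lemma glue_lb_cross_ub : glue_lb c d p q a b l m <= glue_lb c d p q a' b' l' m' + u.
Proof.
move: V V' W S.
move=> [[? ? ? ? ?] [? ? ? ?] [? ? ? ?]] [[? ? ? ? ?] [? ? ? ?] [? ? ? ?]].
move=> [[? ? ? ? ?] [? ? ? ?] [? ? ? ?]].
move=> [[? ? ? ?] [? ? ?] [? ? ? ?] [? ? ? ?] [? ? ? ?]].
have [_ _ _ _] := glue_lbP c d p q a b l m.
have [? ? ? ? _] := glue_lbP c d p q a' b' l' m'.
by case=> ->; lra.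
Qed.
End triangles.

(** An end has bounds [0] and [r] to the two ends, so the formulas across the gluing return the
    bounds it already had in the other frame. *)
Lemma glue_vertexl a b l m : vertex a b l m ->
  glue_ub 0 r a b = a /\ glue_lb 0 r 0 r a b l m = l.
Proof.
move=> [[? ? ? ? ?] [? ? ? ?] [? ? ? ?]].
have [? ? h] := glue_ubP 0 r a b.
have [? ? ? ? h'] := glue_lbP 0 r 0 r a b l m.
by split; [case: h; lra | case: h'; lra].
Qed.

Lemma glue_vertexr a b l m : vertex a b l m ->
  glue_ub r 0 a b = b /\ glue_lb r 0 r 0 a b l m = m.
Proof.
move=> [[? ? ? ? ?] [? ? ? ?] [? ? ? ?]].
have [? ? h] := glue_ubP r 0 a b.
have [? ? ? ? h'] := glue_lbP r 0 r 0 a b l m.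
by split; [case: h; lra | case: h'; lra].
Qed.
End glue_arithmetic.

(** * Frames and the choice of one distance *)

Section frames.
Variables (R : realType) (U : choiceType).
Implicit Types (c x y z u v w : U) (r : R).

Record frame := Frame { pts : set U; ub : U -> U -> R; lb : U -> U -> R }.
Implicit Types s t : frame.

Record is_frame s : Prop := IsFrame {
  ubxx : forall x, pts s x -> ub s x x = 0;
  ub_gt0 : forall x y, pts s x -> pts s y -> x <> y -> 0 < ub s x y;
  ubC : forall x y, pts s x -> pts s y -> ub s x y = ub s y x;
  ub_tri : forall x y z, pts s x -> pts s y -> pts s z ->
    ub s x z <= ub s x y + ub s y z;
  lbxx : forall x, pts s x -> lb s x x = 0;
  lbC : forall x y, pts s x -> pts s y -> lb s x y = lb s y x;
  lb_tri : forall x y z, pts s x -> pts s y -> pts s z ->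
    lb s x z <= lb s x y + ub s y z }.

Lemma lb_ub s x y : is_frame s -> pts s x -> pts s y -> lb s x y <= ub s x y.
Proof. by move=> fs sx sy; have := lb_tri fs sx sx sy; rewrite (lbxx fs) ?add0r. Qed.

Lemma ub_ge0 s x y : is_frame s -> pts s x -> pts s y -> 0 <= ub s x y.
Proof.
move=> fs sx sy; have [->|/eqP xy] := eqVneq x y; first by rewrite (ubxx fs).
exact/ltW/(ub_gt0 fs).
Qed.

(** The diagonal, decided in every frame, is left out, so that the values are positive distances. *)
Definition edge s c x r :=
  [/\ pts s c, pts s x, c <> x, ub s c x = r & lb s c x = r].

Definition finer s t := [/\ pts s `<=` pts t,
  forall x y, pts s x -> pts s y -> ub t x y <= ub s x y &
  forall x y, pts s x -> pts s y -> lb s x y <= lb t x y].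

Lemma finer_refl s : finer s s.
Proof. by split. Qed.

Lemma finer_trans s t s' : finer s t -> finer t s' -> finer s s'.
Proof.
move=> [Pst Ust Lst] [Pt Ut Lt]; split.
- by move=> x /Pst /Pt.
- by move=> x y sx sy; apply: le_trans (Ut _ _ _ _) (Ust _ _ _ _); try apply: Pst.
- by move=> x y sx sy; apply: le_trans (Lst _ _ _ _) (Lt _ _ _ _); try apply: Pst.
Qed.

(** Both bounds of [t] are squeezed between those of [s]. *)
Lemma finer_decided s t x y : is_frame t -> finer s t -> pts s x -> pts s y ->
  ub s x y = lb s x y -> ub t x y = ub s x y /\ lb t x y = ub s x y.
Proof.
move=> ft [Pst Ust Lst] sx sy e; have := Ust _ _ sx sy.
have := Lst _ _ sx sy; have := lb_ub ft (Pst _ sx) (Pst _ sy); lra.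
Qed.

Lemma finer_edge s t c x r : is_frame t -> finer s t -> edge s c x r ->
  edge t c x r.
Proof.
move=> ft st [sc sx ncx uE lE]; have [Pst _ _] := st.
have [|tu tl] := finer_decided ft st sc sx; first by rewrite uE.
by split; rewrite ?tu ?tl //; apply: Pst.
Qed.

Section add_edge.
Variables (s : frame) (x y : U) (r : R).
Hypotheses (fs : is_frame s) (sx : pts s x) (sy : pts s y) (r0 : 0 < r).
Hypotheses (lr : lb s x y < r) (ru : r < ub s x y).

(* The best bounds that follow from those of [s] and from prescribing the distance
   [r] at [x, y]. *)
Let thru u v :=
  Num.min (ub s u x + ub s y v) (ub s u y + ub s x v).
Let thrl u v := Num.max
  (Num.max (lb s x v - ub s y u) (lb s y v - ub s x u))
  (Num.max (lb s x u - ub s y v) (lb s y u - ub s x v)).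

Definition add_edge : frame := Frame (pts s)
  (fun u v => Num.min (ub s u v) (r + thru u v))
  (fun u v => Num.max (lb s u v) (Num.max (r - thru u v) (thrl u v - r))).

Let ubE u v :
  [/\ ub add_edge u v <= ub s u v,
      ub add_edge u v <= r + (ub s u x + ub s y v),
      ub add_edge u v <= r + (ub s u y + ub s x v) &
  [\/ ub add_edge u v = ub s u v,
      ub add_edge u v = r + (ub s u x + ub s y v) |
      ub add_edge u v = r + (ub s u y + ub s x v)]].
Proof.
rewrite /add_edge /=; move: (min_cases (ub s u v) (r + thru u v)).
move: (min_cases (ub s u x + ub s y v) (ub s u y + ub s x v)).
rewrite -/(thru u v); set m := Num.min _ _.
move=> [h1 h2 h3] [h4 h5 h6]; split; try lra.
case: h6 => h6; first by constructor 1.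
by case: h3 => h3; [constructor 2|constructor 3]; rewrite h6 h3.
Qed.

(** Listing the candidates for the maximum turns its unfolding into a case analysis on
    membership. *)
Definition lb_values u v := [:: lb s u v; r - (ub s u x + ub s y v);
  r - (ub s u y + ub s x v); lb s x v - ub s y u - r; lb s y v - ub s x u - r;
  lb s x u - ub s y v - r; lb s y u - ub s x v - r].

Let lbE u v :
  (forall a, a \in lb_values u v -> a <= lb add_edge u v) /\
  (lb add_edge u v \in lb_values u v).
Proof.
rewrite /add_edge /=.
move: (max_cases (lb s u v) (Num.max (r - thru u v) (thrl u v - r))).
move: (max_cases (r - thru u v) (thrl u v - r)).
set m := Num.max (lb s u v) _; set m' := Num.max (r - _) _.
move: (min_cases (ub s u x + ub s y v) (ub s u y + ub s x v)).
rewrite -/(thru u v).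
move: (max_cases (Num.max (lb s x v - ub s y u) (lb s y v - ub s x u))
  (Num.max (lb s x u - ub s y v) (lb s y u - ub s x v))).
rewrite -/(thrl u v).
move: (max_cases (lb s x v - ub s y u) (lb s y v - ub s x u)).
move: (max_cases (lb s x u - ub s y v) (lb s y u - ub s x v)).
set m1 := Num.max _ _; set m2 := Num.max _ _.
move=> [a1 a2 a3] [b1 b2 b3] [c1 c2 c3] [d1 d2 d3] [e1 e2 e3] [f1 f2 f3]; split.
  by move=> a; rewrite /lb_values !inE => /or4P[/eqP->|/eqP->|/eqP->|
    /or4P[/eqP->|/eqP->|/eqP->|/eqP->]]; lra.
rewrite /lb_values !inE.
case: f3 => ->; first by rewrite eqxx.
case: e3 => ->.
  by case: d3 => ->; rewrite eqxx ?orbT.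
by case: c3 => ->; [case: b3 => ->|case: a3 => ->]; rewrite eqxx ?orbT.
Qed.

Let lb_ge u v : let L := lb add_edge u v in
  [/\ lb s u v <= L, r - (ub s u x + ub s y v) <= L,
      r - (ub s u y + ub s x v) <= L, lb s x v - ub s y u - r <= L &
  [/\ lb s y v - ub s x u - r <= L, lb s x u - ub s y v - r <= L &
      lb s y u - ub s x v - r <= L]].
Proof.
have [h _] := lbE u v.
by rewrite /lb_values in h; split; [..|split]; apply: h; rewrite !inE eqxx ?orbT.
Qed.

Lemma add_edge_finer : finer s add_edge.
Proof.
split=> //= u v su sv; first by have [] := ubE u v.
by have [+ _] := lbE u v; apply; rewrite !inE eqxx.
Qed.

(** After each minimum or maximum is replaced by one of its candidates, the axioms follow linearly
    from instances of those of [s]. *)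
Lemma add_edge_frame : is_frame add_edge.
Proof.
have T := ub_tri fs; have LT := lb_tri fs; have UC := ubC fs; have LC := lbC fs.
move: r0 lr ru => r_gt0 lb_r r_ub.
have xy0 : 0 < ub s x y := lt_trans r_gt0 r_ub.
have xx := ubxx fs sx; have yy := ubxx fs sy.
have U0 u v : pts s u -> pts s v -> 0 <= ub s u v by exact: ub_ge0.
have ub'C u v : pts s u -> pts s v -> ub add_edge u v = ub add_edge v u.
  move=> su sv; have := ubE u v; have := ubE v u.
  have := UC _ _ su sv; have := UC _ _ su sx; have := UC _ _ su sy.
  have := UC _ _ sv sx; have := UC _ _ sv sy.
  by move=> ? ? ? ? ? [? ? ?] h [? ? ?]; move: h; case=> ?; case=> ?; lra.
split.
- move=> u su; have := ubE u u; have := ubxx fs su.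
  have := U0 _ _ su sx; have := U0 _ _ su sy.
  have := U0 _ _ sx su; have := U0 _ _ sy su.
  by move=> ? ? ? ? ? [? ? ?]; case; lra.
- move=> u v su sv uv; have := ubE u v; have := ub_gt0 fs su sv uv.
  have := U0 _ _ su sx; have := U0 _ _ su sy.
  have := U0 _ _ sx sv; have := U0 _ _ sy sv.
  by move=> ? ? ? ? ? [? ? ?]; case; lra.
- exact: ub'C.
- move=> u v w su sv sw; have [] := ubE u w.
  have := T _ _ _ su sv sw; have := T _ _ _ su sv sx; have := T _ _ _ su sv sy.
  have := T _ _ _ sx sv sw; have := T _ _ _ sy sv sw.
  rewrite (UC _ _ sx sv) (UC _ _ sy sv).
  have := U0 _ _ sv sx; have := U0 _ _ sv sy.
  have := T _ _ _ su sx sw; have := T _ _ _ su sy sw.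
  move=> ? ? ? ? ? ? ? ? ? ? ? ? _.
  have := ubE u v; have := ubE v w.
  rewrite (UC _ _ sx sv) (UC _ _ sy sv).
  by move=> [_ _ _]; case=> -> [_ _ _]; case=> ->; lra.
(* The two bounds on [r] keep every candidate other than [lb s u u] below zero. *)
- move=> u su; have [_] := lbE u u.
  have [+ _ _ _ _] := lb_ge u u.
  rewrite (lbxx fs su) /lb_values (lbxx fs su) !inE.
  have := T _ _ _ sx su sy; have := UC _ _ su sx; have := UC _ _ su sy.
  have := LT _ _ _ sx sy su; have := LT _ _ _ sy sx su.
  have := LC _ _ sy sx; have := UC _ _ sx sy.
  move=> ? ? ? ? ? ? ? ?; case/or4P=> [/eqP|/eqP|/eqP|/or4P[]/eqP]; lra.
- move=> u v su sv.
  have lb'le a b : pts s a -> pts s b -> lb add_edge a b <= lb add_edge b a.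
    move=> sa sb; have [_] := lbE a b.
    have := LC _ _ sa sb; have := UC _ _ sa sx; have := UC _ _ sa sy.
    have := UC _ _ sb sx; have := UC _ _ sb sy => ? ? ? ? ?.
    have [? ? ? ? [? ? ?]] := lb_ge b a.
    by rewrite !inE; case/or4P=> [/eqP|/eqP|/eqP|/or4P[]/eqP]; lra.
  by apply/le_anti; rewrite !lb'le.
- move=> u v w su sv sw; have [_] := lbE u w.
  have [? ? ? ? [? ? ?]] := lb_ge u v.
  have [_ _ _] := ubE v w.
  have := T _ _ _ su sv sx; have := T _ _ _ su sv sy.
  have := T _ _ _ sv sw sx; have := T _ _ _ sv sw sy.
  have := T _ _ _ sv sx sy; have := T _ _ _ sv sy sx.
  have := T _ _ _ sw sx sy; have := T _ _ _ sw sy sx.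
  have := T _ _ _ su sx sy; have := T _ _ _ su sy sx.
  have := LT _ _ _ su sv sw; have := LT _ _ _ su sv sx; have := LT _ _ _ su sv sy.
  have := LT _ _ _ sx sv sw; have := LT _ _ _ sy sv sw.
  have := LT _ _ _ su sx sw; have := LT _ _ _ su sy sw.
  have := LT _ _ _ sx sy sw; have := LT _ _ _ sy sx sw.
  have := T _ _ _ su sx sv; have := T _ _ _ su sy sv.
  have := lb_ub fs sx sw; have := lb_ub fs sy sw.
  have := LT _ _ _ sv su sv; have := lbxx fs sv; have := LC _ _ su sv.
  have := LT _ _ _ sv sx sv; have := LT _ _ _ sv sy sv.
  have := LC _ _ sy sx; have := UC _ _ sx sy.
  have := LC _ _ su sx; have := LC _ _ su sy.
  have := LC _ _ sv sx; have := LC _ _ sv sy.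
  have := UC _ _ su sx; have := UC _ _ su sy; have := UC _ _ su sv.
  have := UC _ _ sv sx; have := UC _ _ sv sy.
  have := UC _ _ sw sx; have := UC _ _ sw sy.
  have := U0 _ _ su sx; have := U0 _ _ su sy.
  have := U0 _ _ sv sx; have := U0 _ _ sv sy.
  have := U0 _ _ sw sx; have := U0 _ _ sw sy.
  do 47 move=> ?.
  case=> ->; rewrite !inE; (case/or4P=> [/eqP|/eqP|/eqP|/or4P[]/eqP] ->); lra.
Qed.

Lemma add_edge_decided : ub add_edge x y = r /\ lb add_edge x y = r.
Proof.
have := ubE x y.
have [? ? ? ? [? ? ?]] := lb_ge x y.
have := lb_ub add_edge_frame sx sy.
have := ubxx fs sx; have := ubxx fs sy; move: r0 lr ru => r_gt0 lb_r r_ub.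
by move=> ? ? ? [? ? ?]; case; lra.
Qed.

(** This is the strictness that a gluing along [x], [y] requires. A path through [u] either avoids
    the new edge, and then has length at least [ub s x y], or adds a positive length to [r]. *)
Lemma add_edge_strict u : pts s u -> u <> x -> u <> y ->
  r < ub add_edge u x + ub add_edge u y.
Proof.
move=> su ux uy; move: r0 lr ru => r_gt0 lb_r r_ub.
have [_ _ _] := ubE u x; have [_ _ _] := ubE u y.
have := ub_gt0 fs su sx ux; have := ub_gt0 fs su sy uy.
have := ub_tri fs sx su sy; have := ubC fs sx su; have := ubC fs sx sy.
have := ubxx fs sx; have := ubxx fs sy.
by move=> ? ? ? ? ? ? ?; case=> ->; case=> ->; lra.
Qed.

(** Since [r] lies strictly between the old bounds, at every other pair a bound that uses the new
    edge stays away from the opposite bound. *)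
Lemma add_edge_edge u v q : edge add_edge u v q ->
  [\/ edge s u v q, [/\ u = x, v = y & q = r] | [/\ u = y, v = x & q = r]].
Proof.
have T := ub_tri fs; have LT := lb_tri fs; have UC := ubC fs; have LC := lbC fs.
move: r0 lr ru => r_gt0 lb_r r_ub [su sv uv uE lE].
have gt0 := ub_gt0 fs.
have U0 a b : pts s a -> pts s b -> 0 <= ub s a b by exact: ub_ge0.
have [ub_r _] := add_edge_decided.
have [[uxy vxy]|n1] := pselect (u = x /\ v = y).
  by constructor 2; split=> //; rewrite -uE uxy vxy ub_r.
have [[uxy vxy]|n2] := pselect (u = y /\ v = x).
  constructor 3; split=> //; rewrite -uE uxy vxy.
  by rewrite (ubC add_edge_frame sy sx) ub_r.
(* [P1] and [P2] say that neither path from [u] to [v] over the new edge consists of that edge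
   alone. *)
have P1 : 0 < ub s u x + ub s y v.
  have := U0 _ _ su sx; have := U0 _ _ sy sv.
  have [ux|/eqP ux] := eqVneq u x; last by have := gt0 _ _ su sx ux; lra.
  have [vy|/eqP vy] := eqVneq v y; first by case: n1.
  by have := gt0 _ _ sy sv (nesym vy); lra.
have P2 : 0 < ub s u y + ub s x v.
  have := U0 _ _ su sy; have := U0 _ _ sx sv.
  have [uy|/eqP uy] := eqVneq u y; last by have := gt0 _ _ su sy uy; lra.
  have [vx|/eqP vx] := eqVneq v x; first by case: n2.
  by have := gt0 _ _ sx sv (nesym vx); lra.
have [_ lE'] := lbE u v; have [_ _ _ uE'] := ubE u v.
suff [uq lq] : ub s u v = q /\ lb s u v = q by constructor 1.
move: uE' lE'; rewrite !inE lE uE.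
have := gt0 _ _ su sv uv.
have := T _ _ _ sx su sv; have := T _ _ _ sy su sv.
have := T _ _ _ sx sv su; have := T _ _ _ sy sv su.
have := T _ _ _ sx su sy; have := T _ _ _ sx sv sy.
have := T _ _ _ su sx sv; have := T _ _ _ su sy sv.
have := LT _ _ _ sx sy sv; have := LT _ _ _ sy sx sv.
have := LT _ _ _ sx sy su; have := LT _ _ _ sy sx su.
have := LT _ _ _ su sx sv; have := LT _ _ _ su sy sv.
have := lb_ub fs sx su; have := lb_ub fs sy su.
have := lb_ub fs sx sv; have := lb_ub fs sy sv.
have := lb_ub fs su sv.
have := LC _ _ sx sy; have := UC _ _ sx sy.
have := LC _ _ su sx; have := LC _ _ su sy.
have := LC _ _ sv sx; have := LC _ _ sv sy.
have := UC _ _ su sx; have := UC _ _ su sy; have := UC _ _ su sv.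
have := UC _ _ sv sx; have := UC _ _ sv sy.
have := U0 _ _ su sx; have := U0 _ _ su sy.
have := U0 _ _ sv sx; have := U0 _ _ sv sy.
do 35 move=> ?.
case=> ->; (case/or4P=> [/eqP|/eqP|/eqP|/or4P[]/eqP]); lra.
Qed.

End add_edge.
End frames.

(** * Gluing two frames along a decided pair *)

Section glue.
Variables (R : realType) (U : choiceType) (s1 s2 : frame R U) (x y : U) (r : R).
Implicit Types (u v w : U).
Hypotheses (f1 : is_frame s1) (f2 : is_frame s2).
Hypotheses (x1 : pts s1 x) (y1 : pts s1 y) (x2 : pts s2 x) (y2 : pts s2 y).
Hypothesis common : forall u, pts s1 u -> pts s2 u -> u = x \/ u = y.
(* [x = y] with [r = 0] is allowed, and is the gluing at a single point. *)
Hypotheses (ub1 : ub s1 x y = r) (lb1 : lb s1 x y = r).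
Hypotheses (ub2 : ub s2 x y = r) (lb2 : lb s2 x y = r).

Lemma frame_vertex (s : frame R U) u : is_frame s -> pts s x -> pts s y ->
  ub s x y = r -> lb s x y = r -> pts s u ->
  vertex r (ub s u x) (ub s u y) (lb s u x) (lb s u y).
Proof.
move=> fs sx sy us ls su.
have := ub_ge0 fs su sx; have := ub_ge0 fs su sy.
have := ub_tri fs su sx sy; have := ub_tri fs su sy sx; have := ub_tri fs sx su sy.
have := lb_ub fs su sx; have := lb_ub fs su sy.
have := lb_tri fs su sx sy; have := lb_tri fs su sy sx.
have := lb_tri fs sx su sx; have := lb_tri fs sy su sy.
have := lb_tri fs sx su sy; have := lb_tri fs sy su sx.
have := lbxx fs sx; have := lbxx fs sy.
have := ubC fs su sx; have := ubC fs su sy; have := ubC fs sx sy.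
have := lbC fs su sx; have := lbC fs su sy; have := lbC fs sx sy.
do 21 move=> ?.
by split; split; lra.
Qed.

Lemma frame_side (s : frame R U) u v : is_frame s -> pts s x -> pts s y ->
  pts s u -> pts s v ->
  side (ub s u v) (lb s u v) (ub s u x) (ub s u y) (lb s u x) (lb s u y)
    (ub s v x) (ub s v y) (lb s v x) (lb s v y).
Proof.
move=> fs sx sy su sv.
have := lb_ub fs su sv; have := ubC fs su sv; have := lbC fs su sv.
have H z : pts s z -> [/\
  [/\ ub s u z <= ub s u v + ub s v z, ub s v z <= ub s u v + ub s u z &
      ub s u v <= ub s u z + ub s v z],
  [/\ lb s u v <= lb s u z + ub s v z, lb s u v <= lb s v z + ub s u z,
      lb s u z <= lb s u v + ub s v z & lb s v z <= lb s u v + ub s u z] &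
  lb s u z <= lb s v z + ub s u v /\ lb s v z <= lb s u z + ub s u v].
  move=> sz.
  have := lb_ub fs su sv; have := ubC fs su sv; have := lbC fs su sv.
  have := ub_tri fs su sv sz; have := ub_tri fs sv su sz; have := ub_tri fs su sz sv.
  have := lb_tri fs su sv sz; have := lb_tri fs sv su sz; have := lb_tri fs su sz sv.
  have := lb_tri fs sv sz su; have := lb_tri fs sz sv su; have := lb_tri fs sz su sv.
  have := ubC fs su sz; have := ubC fs sv sz; have := lbC fs su sz.
  have := lbC fs sv sz.
  by do 16 move=> ?; split; split; lra.
move=> ? ? ?.
have [[? ? ?] [? ? ? ?] [? ?]] := H _ sx.
by have [[? ? ?] [? ? ? ?] [? ?]] := H _ sy.
Qed.

Let in1 u : bool := `[< pts s1 u >].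
Let side_of u : frame R U := if in1 u then s1 else s2.
Let ubx u := ub (side_of u) u x.
Let uby u := ub (side_of u) u y.
Let lbx u := lb (side_of u) u x.
Let lby u := lb (side_of u) u y.

(** The ends satisfy [in1], so an end and another point of [s2] count as a pair across the gluing;
    [glue2] checks that their bounds are still those of [s2]. *)
Definition glue : frame R U := Frame (pts s1 `|` pts s2)
  (fun u v => if in1 u == in1 v then ub (side_of u) u v else
    glue_ub (ubx u) (uby u) (ubx v) (uby v))
  (fun u v => if in1 u == in1 v then lb (side_of u) u v else
    glue_lb (ubx u) (uby u) (lbx u) (lby u) (ubx v) (uby v) (lbx v) (lby v)).

Let side_frame u : is_frame (side_of u).
Proof. by rewrite /side_of; case: ifP. Qed.

Let side_pts u : pts glue u -> pts (side_of u) u.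
Proof. by rewrite /side_of/in1; case: asboolP => // nu [/nu|]. Qed.

Let side_x u : pts (side_of u) x. Proof. by rewrite /side_of; case: ifP. Qed.
Let side_y u : pts (side_of u) y. Proof. by rewrite /side_of; case: ifP. Qed.

Let vert u : pts glue u -> vertex r (ubx u) (uby u) (lbx u) (lby u).
Proof.
move=> gu; apply: frame_vertex; [exact: side_frame|exact: side_x|
  exact: side_y| | |exact: side_pts]; by rewrite /side_of; case: ifP.
Qed.

Let sides u v : in1 u = in1 v -> side_of v = side_of u.
Proof. by rewrite /side_of => ->. Qed.

Let sideP u v : pts glue u -> pts glue v -> in1 u = in1 v ->
  side (ub glue u v) (lb glue u v) (ubx u) (uby u) (lbx u) (lby u)
    (ubx v) (uby v) (lbx v) (lby v).
Proof.
move=> gu gv uv; rewrite /glue /ubx /uby /lbx /lby /= uv eqxx (sides uv).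
apply: frame_side; [exact: side_frame|exact: side_x|exact: side_y|exact: side_pts|].
by rewrite -(sides uv); exact: side_pts.
Qed.

Let ubS u v : in1 u = in1 v -> ub glue u v = ub (side_of u) u v.
Proof. by move=> uv; rewrite /= uv eqxx. Qed.
Let lbS u v : in1 u = in1 v -> lb glue u v = lb (side_of u) u v.
Proof. by move=> uv; rewrite /= uv eqxx. Qed.
Let ubN u v : in1 u <> in1 v ->
  ub glue u v = glue_ub (ubx u) (uby u) (ubx v) (uby v).
Proof. by move=> /eqP/negPf /= ->. Qed.
Let lbN u v : in1 u <> in1 v -> lb glue u v =
  glue_lb (ubx u) (uby u) (lbx u) (lby u) (ubx v) (uby v) (lbx v) (lby v).
Proof. by move=> /eqP/negPf /= ->. Qed.

Lemma glue1 u v : pts s1 u -> pts s1 v ->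
  ub glue u v = ub s1 u v /\ lb glue u v = lb s1 u v.
Proof.
move=> u1 v1; have i1 w : pts s1 w -> in1 w by move=> w1; apply/asboolP.
have e : in1 u = in1 v by rewrite !i1.
by rewrite ubS // lbS // /side_of i1.
Qed.

Let glueC u v : pts glue u -> pts glue v ->
  ub glue u v = ub glue v u /\ lb glue u v = lb glue v u.
Proof.
move=> gu gv; have [uv|uv] := pselect (in1 u = in1 v).
  have vu := esym uv; rewrite ubS // lbS // (ubS vu) (lbS vu) (sides uv).
  have sv := side_pts gv; rewrite (sides uv) in sv.
  by split; [apply: ubC|apply: lbC] => //; exact: side_pts.
have vu := nesym uv; rewrite ubN // lbN // (ubN vu) (lbN vu).
by rewrite glue_ubC glue_lbC.
Qed.

Lemma glue2 u v : pts s2 u -> pts s2 v ->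
  ub glue u v = ub s2 u v /\ lb glue u v = lb s2 u v.
Proof.
have g2 w : pts s2 w -> pts glue w by right.
have i1 w : pts s1 w -> in1 w = true by move=> w1; apply/asboolP.
have half w z : pts s1 w -> pts s2 w -> pts s2 z -> ~ pts s1 z ->
    ub glue w z = ub s2 w z /\ lb glue w z = lb s2 w z.
  move=> w1 w2 z2 z1; have iz : in1 z = false by apply/asboolP.
  have V := vert (g2 _ z2); rewrite ubN ?lbN ?(i1 _ w1) ?iz //.
  have hl := glue_vertexl V; have hr := glue_vertexr V.
  rewrite (ubC f2 w2 z2) (lbC f2 w2 z2).
  have [wx|wy] := common w1 w2.
    by move: hl; rewrite /ubx /uby /lbx /lby /side_of (i1 _ w1) iz wx ub1 lb1
      (ubxx f1) // (lbxx f1).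
  move: hr; rewrite /ubx /uby /lbx /lby /side_of (i1 _ w1) iz wy.
  by rewrite (ubC f1) // (lbC f1) // ub1 lb1 (ubxx f1) // (lbxx f1).
move=> u2 v2; have [u1|u1] := pselect (pts s1 u); have [v1|v1] := pselect (pts s1 v).
- have [-> ->] := glue1 u1 v1.
  have [->|->] := common u1 u2; have [->|->] := common v1 v2;
  by rewrite ?ub1 ?ub2 ?lb1 ?lb2 ?(ubxx f1) ?(lbxx f1) ?(ubxx f2) ?(lbxx f2)
   ?(ubC f1 y1 x1) ?(lbC f1 y1 x1) ?(ubC f2 y2 x2) ?(lbC f2 y2 x2)
   ?ub1 ?ub2 ?lb1 ?lb2.
- exact: half.
- have [-> ->] := glueC (g2 _ u2) (g2 _ v2).
  by rewrite (ubC f2) // (lbC f2) //; exact: half.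
- have iu : in1 u = false by apply/asboolP.
  have iv : in1 v = false by apply/asboolP.
  by rewrite ubS ?lbS ?iu ?iv // /side_of iu.
Qed.

Let in1_cases u v w : [\/ in1 u = in1 v /\ in1 v = in1 w,
  [/\ in1 u = in1 v, in1 u <> in1 w & in1 v <> in1 w],
  [/\ in1 v = in1 w, in1 u <> in1 v & in1 u <> in1 w] |
  [/\ in1 u = in1 w, in1 u <> in1 v & in1 v <> in1 w]].
Proof.
case: (in1 u); case: (in1 v); case: (in1 w); by
  [constructor 1|constructor 2|constructor 3|constructor 4].
Qed.

Lemma glue_frame : is_frame glue.
Proof.
split.
- move=> u gu; rewrite ubS //; apply: ubxx; [exact: side_frame|exact: side_pts].
- move=> u v gu gv nuv; have [uv|uv] := pselect (in1 u = in1 v).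
    have sv := side_pts gv; rewrite (sides uv) in sv.
    by rewrite ubS //; apply: ub_gt0 => //; exact: side_pts.
  wlog u1 : u v gu gv nuv uv / in1 u.
    move=> W; case/boolP: (in1 u) => [|u1]; first exact: W.
    have [-> _] := glueC gu gv; apply: W => //; [exact: nesym|exact: nesym|].
    by move: uv; rewrite (negPf u1); case: (in1 v).
  have iv : in1 v = false by move: uv; rewrite u1; case: (in1 v).
  have v2 : pts s2 v by case: gv => // v1; move/asboolP: iv.
  have vx : v <> x by move=> vx; move/asboolP: iv; rewrite vx.
  have vy : v <> y by move=> vy; move/asboolP: iv; rewrite vy.
  rewrite ubN //; have [_ _] := glue_ubP (ubx u) (uby u) (ubx v) (uby v).
  have [[? ? _ _ _] _ _] := vert gu.
  have : 0 < ubx v by rewrite /ubx /side_of iv; exact: ub_gt0.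
  have : 0 < uby v by rewrite /uby /side_of iv; exact: ub_gt0.
  by move=> ? ? []->; lra.
- by move=> u v gu gv; case: (glueC gu gv).
- move=> u v w gu gv gw; case: (in1_cases u v w) => [[uv vw]|[uv uw vw]|[vw uv uw]|[uw uv vw]].
  + rewrite !ubS ?uv // -(sides uv) !(sides uv).
    have sv := side_pts gv; have sw := side_pts gw.
    rewrite (sides vw) in sw; rewrite (sides uv) in sv sw.
    by apply: ub_tri => //; exact: side_pts.
  + rewrite (ubN uw) (ubN vw).
    exact: (glue_ub_cross (vert gu) (vert gv) (vert gw) (sideP gu gv uv)).
  + have [-> _] := glueC gu gw; have [-> _] := glueC gv gw; have [-> _] := glueC gu gv.
    rewrite (ubN (nesym uw)) (ubN (nesym uv)) addrC.
    exact: (glue_ub_cross (vert gw) (vert gv) (vert gu) (sideP gw gv (esym vw))).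
  + rewrite (ubN uv) (ubN vw).
    exact: (glue_ub_same (vert gu) (vert gw) (vert gv) (sideP gu gw uw)).
- move=> u gu; rewrite lbS //; apply: lbxx; [exact: side_frame|exact: side_pts].
- by move=> u v gu gv; case: (glueC gu gv).
- move=> u v w gu gv gw; case: (in1_cases u v w) => [[uv vw]|[uv uw vw]|[vw uv uw]|[uw uv vw]].
  + rewrite lbS ?uv // lbS // ubS // -(sides uv) !(sides uv).
    have sv := side_pts gv; have sw := side_pts gw.
    rewrite (sides vw) in sw; rewrite (sides uv) in sv sw.
    by apply: lb_tri => //; exact: side_pts.
  + rewrite (lbN uw) (ubN vw).
    exact: (glue_lb_cross_lb (vert gu) (vert gv) (vert gw) (sideP gu gv uv)).
  + have [-> _] := glueC gv gw; rewrite (lbN uw) (lbN uv).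
    exact: (glue_lb_cross_ub (vert gw) (vert gv) (vert gu) (sideP gw gv (esym vw))).
  + rewrite (lbN uv) (ubN vw).
    exact: (glue_lb_same (vert gu) (vert gw) (vert gv) (sideP gu gw uw)).
Qed.

Lemma glue_finer : finer s1 glue.
Proof.
split; first by left.
- by move=> u v su sv; have [-> _] := glue1 su sv.
- by move=> u v su sv; have [_ ->] := glue1 su sv.
Qed.

Hypothesis strict1 : forall u, pts s1 u -> u <> x -> u <> y ->
  r < ub s1 u x + ub s1 u y.
Hypothesis strict2 : forall u, pts s2 u -> u <> x -> u <> y ->
  r < ub s2 u x + ub s2 u y.

(** By [strict1] and [strict2] no other point lies on a shortest path between the ends, so [glue_lt]
    leaves every new cross pair undecided. *)
Lemma glue_edge u v q : edge glue u v q <-> edge s1 u v q \/ edge s2 u v q.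
Proof.
split; last first.
  move=> [[su sv uv ue le]|[su sv uv ue le]].
    have [gu gl] := glue1 su sv.
    by split; [left|left| |rewrite gu|rewrite gl].
  have [gu gl] := glue2 su sv.
  by split; [right|right| |rewrite gu|rewrite gl].
move=> [gu gv uv ue le].
have [[u1 v1]|n1] := pselect (pts s1 u /\ pts s1 v).
  by have [e1 e2] := glue1 u1 v1; left; rewrite e1 e2 in ue le.
have [[u2 v2]|n2] := pselect (pts s2 u /\ pts s2 v).
  by have [e1 e2] := glue2 u2 v2; right; rewrite e1 e2 in ue le.
exfalso.
wlog u1 : u v gu gv uv ue le n1 n2 / pts s1 u.
  move=> W; case: (gu) => [u1|u2]; first exact: (W u v).
  have [e1 e2] := glueC gu gv; rewrite e1 e2 in ue le.
  apply: (W v u) => //; [exact: nesym|by move=> []; auto|by move=> []; auto|].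
  by case: gv => // v2; case: n2.
have v1 : ~ pts s1 v by move=> v1; apply: n1.
have v2 : pts s2 v by case: gv.
have u2 : ~ pts s2 u by move=> u2; apply: n2.
have iu : in1 u = true by apply/asboolP.
have iv : in1 v = false by apply/asboolP.
have nuv : in1 u <> in1 v by rewrite iu iv.
have vx : v <> x by move=> vx; move: v1; rewrite vx.
have vy : v <> y by move=> vy; move: v1; rewrite vy.
have ux : u <> x by move=> ux; move: u2; rewrite ux.
have uy : u <> y by move=> uy; move: u2; rewrite uy.
move: ue; rewrite -le ubN // lbN //.
suff : glue_lb (ubx u) (uby u) (lbx u) (lby u) (ubx v) (uby v) (lbx v) (lby v) <
  glue_ub (ubx u) (uby u) (ubx v) (uby v) by lra.
apply: (glue_lt (vert gu) (vert gv)); rewrite /ubx /uby /side_of ?iu ?iv;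
  by [exact: ub_gt0|exact: strict1|exact: strict2].
Qed.

End glue.

(** * The line of a floppy monoid *)

Section rational_lines.
Variable R : realType.
Implicit Types (p q r : R).

Lemma rat_line_refl r : rat_line r r.
Proof. by exists 1 => //; rewrite rmorph1 mul1r. Qed.

Lemma rat_line_trans p q r : rat_line p q -> rat_line q r -> rat_line p r.
Proof. by move=> [a _ <-] [b _ <-]; exists (b * a) => //; rewrite rmorphM mulrA. Qed.

Lemma rat_line_sym p q : q != 0 -> rat_line p q -> rat_line q p.
Proof.
move=> q0 [a _ aq]; exists a^-1 => //; rewrite -aq fmorphV mulKf //.
by apply: contra_neq q0 => a0; rewrite -aq a0 mul0r.
Qed.

Lemma rat_lineD r p q : rat_line r p -> rat_line r q -> rat_line r (p + q).
Proof. by move=> [a _ <-] [b _ <-]; exists (a + b) => //; rewrite rmorphD mulrDl. Qed.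

Lemma rat_lineN r p : rat_line r p -> rat_line r (- p).
Proof. by move=> [a _ <-]; exists (- a) => //; rewrite rmorphN mulNr. Qed.

Lemma countable_rat_line r : countable (rat_line r).
Proof.
apply: (@sub_countable _ _ _ [set: rat]); last exact: countableP.
exact: card_image_le.
Qed.

End rational_lines.

Section line.
Variables (R : realType) (N : set R).
Hypotheses (N_ge0 : forall a, N a -> 0 <= a) (N0 : N 0).
Hypotheses (ND : forall a b, N a -> N b -> N (a + b)) (Nfloppy : floppy N).

(* Lengths of the paths with steps in [N] that lead from [0] to [g]. *)
Definition excursions (g : R) : set R :=
  [set s | exists a b, [/\ N a, N b, g = b - a & s = a + b]].

Let exc g := excursions g !=set0.

Lemma excursions_lb g : lbound (excursions g) `|g|.
Proof.
move=> _ [a [b [Na Nb -> ->]]]; have := N_ge0 Na; have := N_ge0 Nb.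
by move=> b0 a0; rewrite ler_norml; lra.
Qed.

Let exc_lb g : has_lbound (excursions g).
Proof. by exists `|g|; exact: excursions_lb. Qed.

Lemma excursionsN g : excursions (- g) = excursions g.
Proof.
suff H h : excursions h `<=` excursions (- h).
  by apply/seteqP; split; [have := H (- g); rewrite opprK|exact: H].
by move=> _ [a [b [Na Nb -> ->]]]; exists b, a; split=> //; rewrite ?opprB ?[a+b]addrC.
Qed.

Lemma excursionsD g h s t : excursions g s -> excursions h t ->
  excursions (g + h) (s + t).
Proof.
move=> [a [b [Na Nb -> ->]]] [c [d [Nc Nd -> ->]]].
exists (a + c), (b + d); split; [exact: ND|exact: ND|lra|lra].
Qed.

Let len g := inf (excursions g).

Let len_ge g : exc g -> `|g| <= len g.
Proof. by move=> eg; apply: lb_le_inf => //; exact: excursions_lb. Qed.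

Let lenN g : len (- g) = len g. Proof. by rewrite /len excursionsN. Qed.

Let lenD g h : exc g -> exc h -> len (g + h) <= len g + len h.
Proof.
move=> eg eh; rewrite -lerBlDl; apply: lb_le_inf => // t ht.
rewrite lerBlDl -lerBlDr; apply: lb_le_inf => // s gs.
by rewrite lerBlDr; apply: ge_inf => //; exact: excursionsD.
Qed.

Lemma excursions_norm g : N `|g| -> excursions g `|g|.
Proof.
move=> Ng; have [g0|g0] := leP 0 g.
  by exists 0, `|g|; split=> //; rewrite ger0_norm //; lra.
by exists `|g|, 0; split=> //; rewrite ltr0_norm //; lra.
Qed.

Let len_norm g : N `|g| -> len g = `|g|.
Proof.
move=> Ng; apply/le_anti; rewrite len_ge ?andbT; last first.
  by exists `|g|; exact: excursions_norm.
by apply: ge_inf => //; exact: excursions_norm.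
Qed.

(** Here floppiness is applied: excursions are symmetric in sign, so the infimum in [floppy] at the
    absolute value of [g] is [len g]. *)
Let norm_len g : exc g -> len g = `|g| -> N `|g|.
Proof.
move=> eg lg; apply: Nfloppy; rewrite -{1}lg.
have {lg} -> : len g = len `|g|.
  by have [g0|g0] := leP 0 g; [rewrite ger0_norm|rewrite ltr0_norm // lenN].
have eg' : exc `|g|.
  by rewrite /exc; have [g0|g0] := leP 0 g;
    [rewrite ger0_norm|rewrite ltr0_norm // excursionsN].
rewrite -ereal_inf_EFin //; congr ereal_inf; apply/seteqP; split.
  by move=> _ [_ [a [b [Na Nb gE ->]]] <-]; exists a, b.
by move=> _ [a [b [Na Nb gE ->]]]; exists (a + b) => //; exists a, b.
Qed.

(** This is the group of differences [N - N], described so that the infimum [len] is taken over a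
    nonempty set. *)
Definition line_pts : set R := [set g | excursions g !=set0].

Definition line_frame : frame R R :=
  Frame line_pts (fun g h => len (g - h)) (fun g h => `|g - h|).

Lemma line_ptsB g h : line_pts g -> line_pts h -> line_pts (g - h).
Proof.
move=> [s gs] [t ht]; exists (s + t); apply: excursionsD => //.
by rewrite excursionsN.
Qed.

Lemma line_ptsD g h : line_pts g -> line_pts h -> line_pts (g + h).
Proof. by move=> [s gs] [t ht]; exists (s + t); exact: excursionsD. Qed.

Lemma line_pts_N g : N `|g| -> line_pts g.
Proof. by move=> Ng; exists `|g|; exact: excursions_norm. Qed.

Lemma line_pts_sub g : line_pts g -> exists a b, [/\ N a, N b & g = b - a].
Proof. by move=> [_ [a [b [Na Nb -> _]]]]; exists a, b. Qed.

Lemma line_is_frame : is_frame line_frame.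
Proof.
split=> /=.
- by move=> g _; rewrite subrr len_norm normr0.
- move=> g h gG hG gh; apply: lt_le_trans (len_ge (line_ptsB gG hG)).
  by rewrite normr_gt0 subr_eq0; apply/eqP.
- by move=> g h _ _; rewrite -opprB lenN.
- move=> g h k gG hG kG; have := lenD (line_ptsB gG hG) (line_ptsB hG kG).
  by rewrite addrA subrK.
- by move=> g _; rewrite subrr normr0.
- by move=> g h _ _; rewrite distrC.
- move=> g h k gG hG kG; apply: le_trans (ler_distD h _ _) _.
  by rewrite lerD2l; exact/len_ge/line_ptsB.
Qed.

Lemma line_ub g h : N `|g - h| -> ub line_frame g h = `|g - h|.
Proof. exact: len_norm. Qed.

Lemma line_edge g h q : edge line_frame g h q <->
  [/\ line_pts g, line_pts h, g <> h, q = `|g - h| & N q].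
Proof.
split=> [[gG hG gh /= uq lq]|[gG hG gh -> Nq]]; last first.
  by split=> //; exact: len_norm.
by split=> //; rewrite -lq; apply: norm_len; [exact: line_ptsB|rewrite lq uq].
Qed.

(** Equality would make both summands equal to the ordinary distances from [g] to [0] and to [r]. By
    floppiness these would lie in [N], and [r] would split into two elements of [N] other than [0]
    and [r]. *)
Lemma line_strict r g : line_pts g -> 0 <= r -> N r ->
  (forall a b, N a -> N b -> a <> 0 -> a <> r -> b <> 0 -> b <> r -> a + b <> r) ->
  g <> 0 -> g <> r -> r < ub line_frame g 0 + ub line_frame g r.
Proof.
move=> gG r0 Nr irr g0 gr.
have rG : line_pts r by apply: line_pts_N; rewrite ger0_norm.
have gG' : line_pts (g - 0) by rewrite subr0.
have := len_ge (line_ptsB gG rG); have := len_ge gG'; rewrite /= subr0.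
have := norm_len (line_ptsB gG rG); have := norm_len gG.
set l := len g; set m := len _ => Nl Nm lg mg.
have tri : r <= `|g| + `|g - r|.
  by have := ler_distD g 0 r; rewrite !sub0r !normrN ger0_norm.
rewrite lt_neqAle; apply/andP; split; last lra.
apply/eqP => rE.
have {}Nl : N `|g| by apply: Nl; lra.
have {}Nm : N `|g - r| by apply: Nm; lra.
have gr' : g - r != 0 by rewrite subr_eq0; apply/eqP.
have ng0 : 0 < `|g| by rewrite normr_gt0; apply/eqP.
have ngr0 : 0 < `|g - r| by rewrite normr_gt0.
by apply: (irr _ _ Nl Nm); lra.
Qed.
End line.

(** * Distance relations whose spheres are antipodal pairs *)

Section good.
Variables (R : realType) (M : set R).

(* [E c x q] reads: [x] is at decided distance [q] from [c]. *)
Definition good (T : Type) (E : T -> T -> R -> Prop) :=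
  [/\ forall c x q, E c x q -> M q /\ 0 < q,
    forall c x q, E c x q -> exists y, [/\ E c y q, E x y (2 * q) &
      forall z, E c z q -> z = x \/ z = y] &
    forall c x q p, E c x q -> M p -> p <> 0 -> rat_line q p ->
      exists y, E c y p].

(** Distances of the two relations at a common centre are incommensurable, so no sphere receives
    points from both. *)
Lemma good_union (T : Type) (E F : T -> T -> R -> Prop) : good E -> good F ->
  (forall c x y p q, E c x p -> F c y q -> ~ rat_line p q) ->
  good (fun c x q => E c x q \/ F c x q).
Proof.
move=> [Ev Es Ec] [Fv Fs Fc] EF; split.
- by move=> c x q [/Ev|/Fv].
- move=> c x q [cx|cx].
    have [y [cy xy cz]] := Es _ _ _ cx; exists y; split; [by left|by left|].
    move=> z [/cz//|Fcz]; have := EF _ _ _ _ _ cx Fcz.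
    by case; exact: rat_line_refl.
  have [y [cy xy cz]] := Fs _ _ _ cx; exists y; split; [by right|by right|].
  move=> z [Ecz|/cz//]; have := EF _ _ _ _ _ Ecz cx.
  by case; exact: rat_line_refl.
- move=> c x q p [cx|cx] Mp p0 qp.
    by have [y ?] := Ec _ _ _ _ cx Mp p0 qp; exists y; left.
  by have [y ?] := Fc _ _ _ _ cx Mp p0 qp; exists y; right.
Qed.

Lemma good_ext (T : Type) (E F : T -> T -> R -> Prop) :
  (forall c x q, E c x q <-> F c x q) -> good E -> good F.
Proof.
move=> EF; suff -> : E = F by [].
by apply/funext => c; apply/funext => x; apply/funext => q; apply/propext.
Qed.

End good.

Lemma countable_setU (T : Type) (A B : set T) :
  countable A -> countable B -> countable (A `|` B).
Proof.
move=> cA cB; rewrite -bigcup2E.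
by apply: bigcup_countable => [|[|[|i]] //= _]; exact: countableP.
Qed.

(** * Copying a frame into the ambient set *)

Section pull.
Variables (R : realType) (U V : choiceType) (f : V -> U) (h : U -> V).
Variable s : frame R V.
Hypothesis fK : forall g, pts s g -> h (f g) = g.

Definition pull : frame R U := Frame (f @` pts s)
  (fun u v => ub s (h u) (h v)) (fun u v => lb s (h u) (h v)).

Lemma pull_frame : is_frame s -> is_frame pull.
Proof.
move=> fs; split=> /=.
- by move=> _ [g gs <-]; rewrite fK //; exact: ubxx.
- move=> _ _ [g gs <-] [k ks <-] gk; rewrite !fK //; apply: ub_gt0 => // e.
  by apply: gk; rewrite e.
- by move=> _ _ [g gs <-] [k ks <-]; rewrite !fK //; exact: ubC.
- by move=> _ _ _ [g gs <-] [k ks <-] [l ls <-]; rewrite !fK //; exact: ub_tri.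
- by move=> _ [g gs <-]; rewrite fK //; exact: lbxx.
- by move=> _ _ [g gs <-] [k ks <-]; rewrite !fK //; exact: lbC.
- by move=> _ _ _ [g gs <-] [k ks <-] [l ls <-]; rewrite !fK //; exact: lb_tri.
Qed.

Lemma pull_edge u v q : edge pull u v q <->
  exists g k, [/\ u = f g, v = f k & edge s g k q].
Proof.
split=> [[[g gs <-] [k ks <-] gk]|[g [k [-> -> [gs ks gk uq lq]]]]].
  rewrite /= !fK // => uq lq; exists g, k; split=> //; split=> // e.
  by apply: gk; rewrite e.
split; rewrite /= ?fK //; [by exists g|by exists k|].
by move=> e; apply: gk; rewrite -(fK gs) -(fK ks) e.
Qed.

Lemma good_pull M : good M (edge s) -> good M (edge pull).
Proof.
move=> [Ev Es Ec].
apply: (@good_ext _ _ _ (fun u v q => exists g k, [/\ u = f g, v = f k & edge s g k q])).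
  by move=> u v q; split=> /pull_edge.
split.
- by move=> u v q [g [k [_ _ /Ev]]].
- move=> _ _ q [g [k [-> -> gk]]]; have [l [gl kl glz]] := Es _ _ _ gk.
  exists (f l); split; [by exists g, l|by exists k, l|].
  move=> _ [g' [z [gg' -> gz]]].
  have gE : g = g' by case: gk gz => gs _ _ _ _ [gs' _ _ _ _]; rewrite -(fK gs) gg' fK.
  by rewrite -gE in gz; have [->|->] := glz _ gz; [left|right].
- move=> _ v q p [g [k [-> _ gk]]] Mp p0 qp.
  by have [l gl] := Ec _ _ _ _ gk Mp p0 qp; exists (f l), g, l.
Qed.

End pull.

(** The complement of a countable set in [U] is infinite and has room for the countable [G]. The
    equivalence of [x = y] and [r = 0] also covers gluing at a single point. *)
Lemma fresh_embedding (R : realType) (U : pointedType) (P : set U) (G : set R)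
    (x y : U) (r : R) : ~ countable [set: U] -> countable P -> countable G ->
  (x = y <-> r = 0) ->
  exists (f : R -> U) (h : U -> R), [/\ f 0 = x, f r = y,
    forall g, G g \/ g = 0 \/ g = r -> h (f g) = g &
    forall g, G g -> P (f g) -> g = 0 \/ g = r].
Proof.
move=> Uunc Pc Gc xy.
have [e eU e_inj] : exists2 e : R -> U, (forall g, G g -> ~ (P `|` [set x; y]) (e g)) &
    {in G &, injective e}.
  have inf : ~ finite_set (~` (P `|` [set x; y])).
    move=> /finite_set_countable Cc; apply: Uunc.
    rewrite -(setUv (P `|` [set x; y])); apply: countable_setU => //.
    apply: countable_setU => //.
    by apply: finite_set_countable; exact: finite_set2.
  have : (G #<= ~` (P `|` [set x; y]))%card.
    by apply: card_le_trans Gc _; apply/infiniteP.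
  move=> /pcard_leP/injfunPex[e eU e_inj]; exists e => //.
(* [e] avoids [x] and [y] as well, so overriding it at [0] and [r] keeps the map injective. *)
pose f g := if g == 0 then x else if g == r then y else e g.
have f0 : f 0 = x by rewrite /f eqxx.
have fr : f r = y.
  rewrite /f eqxx; case: eqP => // r0; exact/xy.
have fe g : g <> 0 -> g <> r -> f g = e g.
  by rewrite /f => /eqP/negPf -> /eqP/negPf ->.
pose D g := G g \/ g = 0 \/ g = r.
have f_inj g k : D g -> D k -> f g = f k -> g = k.
  have fx g' : D g' -> f g' = x -> g' = 0.
    move=> Dg'; have [//|g0] := pselect (g' = 0).
    have [->|gr] := pselect (g' = r).
      by rewrite fr => /esym/xy.
    rewrite fe // => ex; case: Dg' => [/eU|[]//].
    by case; right; left.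
  have fy g' : D g' -> f g' = y -> g' = r.
    move=> Dg'; have [->|g0] := pselect (g' = 0).
      by rewrite f0 => /xy.
    have [//|gr] := pselect (g' = r).
    rewrite fe // => ex; case: Dg' => [/eU|[]//].
    by case; right; right.
  move=> Dg Dk; have [->|g0] := pselect (g = 0).
    by rewrite f0 => /esym/fx ->.
  have [->|gr] := pselect (g = r).
    by rewrite fr => /esym/fy ->.
  have [->|k0] := pselect (k = 0).
    by rewrite f0 => /fx ->.
  have [->|kr] := pselect (k = r).
    by rewrite fr => /fy ->.
  rewrite !fe //; case: Dg => [Gg|[]//]; case: Dk => [Gk|[]//].
  by apply: e_inj; rewrite inE.
exists f, (fun u => xget 0 [set g | D g /\ f g = u]); split=> //.
  by move=> g Dg; case: xgetP => [k _ [Dk /f_inj]|/(_ g)]; [apply|case].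
move=> g Gg; have [->|g0] := pselect (g = 0); first by left.
have [->|gr] := pselect (g = r); first by right.
by rewrite fe // => Pe; case: (eU _ Gg); left.
Qed.

(** * Attaching a line *)

Section attach.
Variables (R : realType) (M : set R).
Hypothesis M_ge0 : forall a, M a -> 0 <= a.
Hypothesis M_line : forall r, M r ->
  floppy (M `&` rat_line r) /\ is_monoid (M `&` rat_line r).

Section rational_line.
Variable b : R.
Hypothesis Mb : M b.
Let N := M `&` rat_line b.

Lemma line_ge0 a : N a -> 0 <= a. Proof. by move=> [/M_ge0]. Qed.
Lemma line_mem0 : N 0. Proof. by have [_ []] := M_line Mb. Qed.
Lemma line_memD a c : N a -> N c -> N (a + c).
Proof. by move=> Na Nc; have [_ [_ NE]] := M_line Mb; rewrite /N NE; exists a => //; exists c. Qed.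
Lemma line_floppy : floppy N. Proof. by have [] := M_line Mb. Qed.

Lemma countable_line : countable (line_pts N).
Proof.
apply: sub_countable (countable_rat_line b); apply: subset_card_le => g.
move=> /line_pts_sub[a [c [[_ ba] [_ bc] ->]]].
by apply: rat_lineD => //; exact: rat_lineN.
Qed.

Lemma good_line : good M (edge (line_frame N)).
Proof.
have N_ge0 := line_ge0; have N0 := line_mem0; have ND := line_memD.
have lineP g h q := line_edge N_ge0 N0 ND line_floppy g h q.
split.
- move=> g h q /lineP[gG hG gh -> [Mq _]]; split=> //.
  by rewrite normr_gt0 subr_eq0; apply/eqP.
(* The antipode of [h] is its reflection in [g]. *)
- move=> g h q /lineP[gG hG gh qE Nq]; exists (g + (g - h)).
  have yG : line_pts N (g + (g - h)).
    by apply: line_ptsD => //; exact: line_ptsB.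
  have gh0 : g - h != 0 by rewrite subr_eq0; apply/eqP.
  have q0 : 0 < q by rewrite qE normr_gt0.
  split.
  + apply/lineP; split=> //.
      by move=> e; apply: gh; lra.
    by rewrite opprD addNKr normrN.
  + apply/lineP; split=> //.
    * by move=> e; apply: gh; lra.
    * rewrite (_ : h - _ = - (2 * (g - h))); last lra.
      by rewrite normrN normrM -qE ger0_norm.
    * by rewrite mulr_natl mulr2n; exact: ND.
  + move=> z /lineP[_ zG _ qz _]; have : `|g - z| = `|g - h| by rewrite -qz.
    have [gz0|gz0] := leP 0 (g - z); have [gh1|gh1] := leP 0 (g - h);
    rewrite ?(ger0_norm gz0) ?(ltr0_norm gz0) ?(ger0_norm gh1) ?(ltr0_norm gh1);
    by move=> ?; (left; lra) || (right; lra).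
- move=> g h q p /lineP[gG hG gh qE [Mq bq]] Mp p0 qp; exists (g + p).
  have Np : N p by split=> //; exact: rat_line_trans qp.
  have pp : `|p| = p by rewrite ger0_norm // N_ge0.
  have pG : line_pts N p by apply: (line_pts_N N0); rewrite pp.
  apply/lineP; split=> //; [exact: line_ptsD| |by rewrite opprD addNKr normrN].
  by move=> e; apply: p0; lra.
Qed.
End rational_line.

(** [E] stands for the decided pairs before [r] was prescribed at [x], [y]: it is good, whereas
    [edge s] may fail to be good at that one pair until the line supplies its spheres. With [x = y]
    and [r = 0] the line is attached at a point. *)
Lemma attach (U : pointedType) (s : frame R U) (E : U -> U -> R -> Prop) x y r b :
  ~ countable [set: U] -> is_frame s -> countable (pts s) ->
  pts s x -> pts s y -> ub s x y = r -> lb s x y = r ->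
  M b -> 0 < b -> (M `&` rat_line b) r ->
  (forall a c, (M `&` rat_line b) a -> (M `&` rat_line b) c ->
    a <> 0 -> a <> r -> c <> 0 -> c <> r -> a + c <> r) ->
  (forall u, pts s u -> u <> x -> u <> y -> r < ub s u x + ub s u y) ->
  good M E -> (forall u v q, E u v q -> edge s u v q) ->
  (forall u v q, edge s u v q ->
    [\/ E u v q, [/\ u = x, v = y & q = r] | [/\ u = y, v = x & q = r]]) ->
  (forall v q, E x v q \/ E y v q -> ~ rat_line b q) ->
  exists t, [/\ is_frame t, finer s t, countable (pts t), good M (edge t) &
    (forall u v q, edge t u v q -> E u v q \/ rat_line b q) /\
    forall p, M p -> p <> 0 -> rat_line b p -> exists v, edge t x v p].
Proof.
move=> Uunc fs sc sx sy uxy lxy Mb b0 Nr irr strict gE Es sE nocommon.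
set N := M `&` rat_line b in Nr irr.
have N_ge0 := line_ge0 (b := b); have N0 := line_mem0 Mb.
have ND := line_memD Mb; have NF := line_floppy Mb.
have lineP g h q := line_edge N_ge0 N0 ND NF g h q.
have r_ge0 : 0 <= r by exact: N_ge0.
have xy : x = y <-> r = 0.
  split=> [xy|r0]; first by rewrite -uxy xy (ubxx fs).
  by apply: contrapT => xy; have := ub_gt0 fs sx sy xy; rewrite uxy r0 ltxx.
have [f [h [f0 fr fK fP]]] := fresh_embedding Uunc sc (countable_line b) xy.
have {}fK g : pts (line_frame N) g -> h (f g) = g by move=> gG; apply: fK; left.
pose s2 := pull f h (line_frame N).
have f2 : is_frame s2 by apply: pull_frame => //; exact: line_is_frame.
have G0 : line_pts N 0 by apply: (line_pts_N N0); rewrite normr0.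
have Gr : line_pts N r by apply: (line_pts_N N0); rewrite ger0_norm.
have x2 : pts s2 x by exists 0.
have y2 : pts s2 y by exists r.
have common u : pts s u -> pts s2 u -> u = x \/ u = y.
  by move=> su [g gG gu]; move: su; rewrite -gu => /(fP _ gG)[]->; [left|right].
have hx : h x = 0 by rewrite -f0 fK.
have hy : h y = r by rewrite -fr fK.
have u2 : ub s2 x y = r.
  rewrite -[LHS]/(ub (line_frame N) (h x) (h y)) hx hy line_ub //;
  by rewrite sub0r normrN ger0_norm.
have l2 : lb s2 x y = r.
  by rewrite -[LHS]/`|h x - h y| hx hy sub0r normrN ger0_norm.
have strict2 u : pts s2 u -> u <> x -> u <> y -> r < ub s2 u x + ub s2 u y.
  move=> [g gG <-] gx gy.
  rewrite -[ub s2 _ x]/(ub (line_frame N) (h (f g)) (h x)).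
  rewrite -[ub s2 _ y]/(ub (line_frame N) (h (f g)) (h y)) fK // hx hy.
  apply: line_strict => //.
    by move=> g0; apply: gx; rewrite g0.
  by move=> gr; apply: gy; rewrite gr.
pose t := glue s s2 x y.
have tE u v q : edge t u v q <-> edge s u v q \/ edge s2 u v q.
  exact: (glue_edge fs f2 sx sy x2 y2 common uxy lxy u2 l2 strict strict2 u v q).
have xyE : x <> y -> edge s2 x y r /\ edge s2 y x r.
  move=> nxy; split; split=> //; rewrite ?(ubC f2 y2 x2) ?(lbC f2 y2 x2) //.
  exact: nesym.
have s2E u v q : edge s2 u v q -> rat_line b q /\ q <> 0.
  move=> /pull_edge-/(_ fK)[g [k [_ _ /lineP[_ _ gk qE [_ bq]]]]]; split=> //.
  by rewrite qE => /eqP; rewrite normr_eq0 subr_eq0 => /eqP.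
(* The pair [x], [y], possibly missing from [E], reappears as an edge of the new line. *)
have tE' u v q : edge t u v q <-> E u v q \/ edge s2 u v q.
  rewrite tE; split=> [[e|e]|[e|e]]; [|by right|by left; exact: Es|by right].
  have [|[ux vy qr]|[uy vx qr]] := sE _ _ _ e; first by left.
    right; rewrite ux vy qr; apply: (proj1 (xyE _)).
    by case: e => _ _ + _ _; rewrite ux vy.
  right; rewrite uy vx qr; apply: (proj2 (xyE _)).
  by case: e => _ _ + _ _; rewrite uy vx => /nesym.
exists t; split.
- exact: (glue_frame fs f2 sx sy x2 y2 uxy lxy u2 l2).
- exact: glue_finer.
- apply: countable_setU => //; apply: sub_countable (countable_line b).
  exact: card_image_le.
- apply: (@good_ext _ _ _ (fun c v q => E c v q \/ edge s2 c v q)).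
    by move=> c v q; rewrite tE'.
  apply: good_union => //; first by apply: good_pull => //; exact: good_line.
  (* A common centre is [x] or [y], where [nocommon] excludes distances commensurable with [b]. *)
  move=> c v w p q cv cw pq; have [bq q0] := s2E _ _ _ cw.
  have cE : E x v p \/ E y v p.
    have [cs _ _ _ _] := Es _ _ _ cv; have [c2 _ _ _ _] := cw.
    by have [cx|cy] := common _ cs c2; [left; rewrite -cx|right; rewrite -cy].
  apply: (nocommon _ _ cE); apply: rat_line_trans bq _.
  by apply: rat_line_sym => //; exact/eqP.
- split=> [u v q /tE'[|/s2E[]]|p Mp p0 bp]; [by left|by right|].
  have Np : N p by [].
  have pE : `|p| = p by rewrite ger0_norm // N_ge0.
  exists (f p); apply/tE; right; apply/pull_edge => //; exists 0, p; split=> //.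
  apply/lineP; split=> //; [by apply: (line_pts_N N0); rewrite pE|exact: nesym|].
  by rewrite sub0r normrN pE.
Qed.
End attach.

(** * Elementary moves: realising a distance at a point, deciding a pair *)

Section steps.
Variables (R : realType) (M : set R) (U : pointedType).
Hypothesis Uunc : ~ countable [set: U].
Hypothesis M_ge0 : forall a, M a -> 0 <= a.
Hypothesis M_line : forall r, M r ->
  floppy (M `&` rat_line r) /\ is_monoid (M `&` rat_line r).
Variable B : set R.

Definition spanned (A : set R) (s : frame R U) :=
  forall u v q, edge s u v q -> rat_scale A q.

(* [B] contains the distances used before the current round; the [omega] steps of
   the round add finitely many at a time. *)
Definition state s := [/\ is_frame s, countable (pts s), good M (edge s) &
  exists F, [/\ finite_set F, F `<=` M & spanned (B `|` F) s]].

Lemma rat_scale_line (A : set R) p q : rat_scale A q -> rat_line q p -> rat_scale A p.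
Proof.
move=> [a _ [b Ab <-]] [c _ <-]; exists (c * a) => //; exists b => //.
by rewrite rmorphM mulrA.
Qed.

Lemma rat_scaleS (A C : set R) : A `<=` C -> rat_scale A `<=` rat_scale C.
Proof. by move=> AC _ [a _ [b /AC Cb <-]]; exists a => //; exists b. Qed.

Lemma rat_scale_mem (A : set R) a : A a -> rat_scale A a.
Proof. by move=> Aa; exists 1 => //; exists a => //; rewrite rmorph1 mul1r. Qed.

Lemma spanned_extend (s t : frame R U) (F : set R) b :
  finite_set F -> F `<=` M -> spanned (B `|` F) s -> M b ->
  (forall u v q, edge t u v q -> edge s u v q \/ rat_line b q) ->
  exists F', [/\ finite_set F', F' `<=` M & spanned (B `|` F') t].
Proof.
move=> Ffin FM Fs Mb ts; exists (F `|` [set b]); split.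
- by rewrite finite_setU; split=> //; exact: finite_set1.
- by move=> q [/FM|->].
- move=> u v q /ts[/Fs|bq]; first by apply: rat_scaleS => p [Bp|Fp]; [left|right; left].
  by apply: rat_scale_line bq; apply: rat_scale_mem; right; right.
Qed.

(** If some distance at [z] is commensurable with [m], goodness already provides the point.
    Otherwise the line of [m] is attached at [z] alone. *)
Lemma fill s z m : state s -> pts s z -> M m -> m <> 0 ->
  exists t, [/\ state t, finer s t & exists y, edge t z y m].
Proof.
move=> st sz Mm m0; have [fs sc gs [F [Ffin FM Fs]]] := st.
have [Ev Es Ec] := gs.
have [[v [q [zv qm]]]|none] := pselect (exists v q, edge s z v q /\ rat_line q m).
  by exists s; split=> //; [exact: finer_refl|exact: Ec zv Mm m0 qm].
have m_gt0 : 0 < m by rewrite lt_neqAle M_ge0 // eq_sym; move/eqP: m0 => ->.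
have N0 : (M `&` rat_line m) 0 by have [_ []] := M_line Mm.
have [|||||t [ft st' tc gt [tE tm]]] := attach M_ge0 M_line Uunc fs sc sz sz
  (ubxx fs sz) (lbxx fs sz) Mm m_gt0 N0 _ _ gs.
- move=> a c [/M_ge0 a_ge0 _] [/M_ge0 c_ge0 _] a0 _ c0 _ ac.
  by apply: a0; lra.
- by move=> u su uz _; have := ub_gt0 fs su sz uz; lra.
- by [].
- by move=> u v q; constructor 1.
- move=> v q zv mq; apply: none; exists v, q.
  have {}zv : edge s z v q by case: zv.
  split=> //; apply: rat_line_sym => //; have [_] := Ev _ _ _ zv.
  by rewrite lt_neqAle eq_sym => /andP[].
exists t; split=> //; last by apply: tm => //; exact: rat_line_refl.
split=> //; exact: spanned_extend Fs Mm tE.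
Qed.

Hypothesis dense_ddot : forall F, finite_set F -> F `<=` M ->
  `[0, +oo[ `<=` closure (ddot M `\`
     set_add (rat_scale (B `|` F)) (rat_scale (B `|` F))).

Lemma ddot_between (F : set R) p q : finite_set F -> F `<=` M ->
  0 <= p -> p < q -> exists r, [/\ p < r, r < q, ddot M r & ~ rat_scale (B `|` F) r].
Proof.
move=> Ffin FM p0 pq.
have mid0 : `[0, +oo[%classic ((p + q) / 2) by rewrite /= in_itv /= andbT; lra.
have e0 : 0 < (q - p) / 2 by lra.
have [r [[rM rB] pr]] := dense_ddot Ffin FM mid0 (nbhsx_ballx _ _ e0).
move: pr; rewrite /ball /= ltr_norml => /andP[pr qr].
exists r; split=> //; [lra|lra|move=> Br; apply: rB].
(* [0] is a rational multiple of an element of the same set, so a member of the span also lies in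
   the sum of two spans that density avoids. *)
exists r => //; exists 0; last by rewrite addr0.
by case: Br => _ _ [b Bb _]; exists 0 => //; exists b => //; rewrite rmorph0 mul0r.
Qed.

(** A value from [ddot_between] is prescribed at an undecided pair, and its line is attached at once
    to restore goodness. *)
Lemma decide s x y : state s -> pts s x -> pts s y ->
  exists t, [/\ state t, finer s t & ub t x y = lb t x y].
Proof.
move=> st sx sy; have [fs sc gs [F [Ffin FM Fs]]] := st.
have [uly|ul] := pselect (ub s x y = lb s x y).
  by exists s; split=> //; exact: finer_refl.
have nxy : x <> y by move=> xy; apply: ul; rewrite xy (ubxx fs) ?(lbxx fs).
have u0 := ub_gt0 fs sx sy nxy.
(* The lower bound may be negative, and the new distance has to be positive. *)
have lu : Num.max 0 (lb s x y) < ub s x y.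
  rewrite gt_max u0 lt_neqAle lb_ub // andbT; apply/eqP; exact: nesym.
have [|r [lr ru [[Mr r_neq0] irr] rB]] := ddot_between Ffin FM _ lu.
  by rewrite le_max lexx.
move: lr; rewrite gt_max => /andP[r0 lr].
have Nr : (M `&` rat_line r) r by split=> //; exact: rat_line_refl.
have [ub_r lb_r] := add_edge_decided fs sx sy r0 lr ru.
have fin := add_edge_finer s x y r.
have [||||t [ft st' tc gt [tE tm]]] := attach M_ge0 M_line Uunc
  (add_edge_frame fs sx sy r0 lr ru) sc sx sy ub_r lb_r Mr r0 Nr _
  (add_edge_strict fs sx sy r0 lr ru) gs.
- move=> a c Na Nc a0 ar c0 cr; apply: irr.
    by split=> // -[].
  by split=> // -[].
- by move=> u v q; exact: (finer_edge (add_edge_frame fs sx sy r0 lr ru) fin).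
- exact: (add_edge_edge fs sx sy r0 lr ru).
(* A distance at [x] or [y] commensurable with [r] would put [r] into the span of the distances of
   [s]. *)
- move=> v q xyv rq; apply: rB.
  have [c qc] : exists c, edge s c v q by case: xyv; [exists x|exists y].
  apply: rat_scale_line (Fs _ _ _ qc) _.
  by apply: rat_line_sym rq; have [Ev _ _] := gs; have [_] := Ev _ _ _ qc;
    rewrite lt_neqAle eq_sym => /andP[].
exists t; split.
- by split=> //; exact: spanned_extend Fs Mr tE.
- exact: finer_trans fin st'.
- by have [-> ->] := finer_decided ft st' sx sy (etrans ub_r (esym lb_r)).
Qed.

(** This is the move repeated during a round: applied to all triples of points, it makes the limit
    [full]. *)
Lemma decide_fill s x y z : state s -> pts s x -> pts s y -> pts s z ->
  exists t, [/\ state t, finer s t, ub t x y = lb t x y &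
    x <> y -> exists w, edge t z w (ub t x y)].
Proof.
move=> st sx sy sz; have [t [tst stt txy]] := decide st sx sy.
have [[Pst _ _] [ft _ gt _]] := (stt, tst).
have [xy|nxy] := pselect (x = y); first by exists t; split=> // /(_ xy).
have exy : edge t x y (ub t x y) by split=> //; apply: Pst.
have [/(_ _ _ _ exy)[Mr r0] _ _] := gt.
have [|t' [st' tt' zw]] := fill tst (Pst _ sz) Mr.
  by move=> r_0; rewrite r_0 ltxx in r0.
have [ft' _ _ _] := st'.
have [e1 e2] := finer_decided ft' tt' (Pst _ sx) (Pst _ sy) txy.
exists t'; split=> //; [exact: finer_trans tt'|by rewrite e1 e2|by rewrite e1].
Qed.

End steps.

(** * Limits of directed families of frames *)

Section full_frames.
Variables (R : realType) (M : set R) (U : choiceType).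
Implicit Types s t : frame R U.

(** The second clause makes every sphere of a realised radius nonempty; [good] then turns it into an
    antipodal pair. *)
Definition full s :=
  (forall x y, pts s x -> pts s y -> ub s x y = lb s x y) /\
  (forall c x q z, edge s c x q -> pts s z -> exists y, edge s z y q).

Section limit.
Variable F : set (frame R U).
Hypothesis Fframe : forall s, F s -> is_frame s.
Hypothesis Fgood : forall s, F s -> good M (edge s).
Hypothesis Fdir : forall s t, F s -> F t ->
  exists u, [/\ F u, finer s u & finer t u].
Hypothesis Fdecide : forall s x y, F s -> pts s x -> pts s y ->
  exists t, [/\ F t, pts t x, pts t y & ub t x y = lb t x y].
Hypothesis Ffill : forall s c x q z, F s -> edge s c x q -> pts s z ->
  exists t y, F t /\ edge t z y q.

(** Decided values persist, so by directedness all frames that decide a pair agree on it. The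
    default [0] is taken only where no frame decides. *)
Definition limit_dist (x y : U) : R := xget 0 [set q | exists s,
  [/\ F s, pts s x, pts s y, ub s x y = q & lb s x y = q]].

Definition limit : frame R U :=
  Frame (\bigcup_(s in F) pts s) limit_dist limit_dist.

Lemma limit_distE s x y : F s -> pts s x -> pts s y -> ub s x y = lb s x y ->
  limit_dist x y = ub s x y.
Proof.
move=> Fs sx sy uly; rewrite /limit_dist; case: xgetP => [q _|/(_ (ub s x y))].
  move=> [t [Ft tx ty utq ltq]].
  have [v [Fv sv tv]] := Fdir Fs Ft.
  have [<- _] := finer_decided (Fframe Fv) sv sx sy uly.
  by have [->] := finer_decided (Fframe Fv) tv tx ty (etrans utq (esym ltq)).
by case; exists s; split.
Qed.

Let above2 s t x y : F s -> F t -> pts s x -> pts t y ->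
  exists v, [/\ F v, finer s v, finer t v, pts v x & pts v y].
Proof.
move=> Fs Ft sx ty; have [v [Fv sv tv]] := Fdir Fs Ft.
have [[Psv _ _] [Ptv _ _]] := (sv, tv).
by exists v; split=> //; [exact: Psv|exact: Ptv].
Qed.

Lemma limit_decided s x y : F s -> pts s x -> pts s y -> exists t,
  [/\ F t, finer s t, ub t x y = limit_dist x y & lb t x y = limit_dist x y].
Proof.
move=> Fs sx sy; have [t [Ft tx ty uly]] := Fdecide Fs sx sy.
have [v [Fv sv tv vx vy]] := above2 Fs Ft sx ty.
have [uv lv] := finer_decided (Fframe Fv) tv tx ty uly.
by exists v; rewrite uv lv (limit_distE Ft tx ty uly).
Qed.

Let above3 x y z : pts limit x -> pts limit y -> pts limit z -> exists s,
  [/\ F s, pts s x, pts s y & pts s z].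
Proof.
move=> [s Fs sx] [t Ft ty] [w Fw wz].
have [v [Fv sv tv vx vy]] := above2 Fs Ft sx ty.
have [v' [Fv' [vv' _ _] _ vx' vz']] := above2 Fv Fw vx wz.
by exists v'; split=> //; exact: vv'.
Qed.

Lemma limit_finer s : F s -> finer s limit.
Proof.
move=> Fs; split=> [x sx|x y sx sy|x y sx sy]; first by exists s.
  by have [t [_ [_ ut _] /= <- _]] := limit_decided Fs sx sy; exact: ut.
by have [t [_ [_ _ lt] _ /= <-]] := limit_decided Fs sx sy; exact: lt.
Qed.

Lemma limit_frame : is_frame limit.
Proof.
have pair x y : pts limit x -> pts limit y -> exists s, [/\ F s, pts s x, pts s y,
    ub s x y = limit_dist x y & lb s x y = limit_dist x y].
  move=> lx ly; have [s [Fs sx sy _]] := above3 lx ly lx.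
  have [t [Ft [st _ _] ut lt]] := limit_decided Fs sx sy.
  by exists t; split=> //; exact: st.
have d0 x : pts limit x -> limit_dist x x = 0.
  by move=> lx; have [s [Fs sx _ <- _]] := pair _ _ lx lx; exact: (ubxx (Fframe Fs)).
have dC x y : pts limit x -> pts limit y -> limit_dist x y = limit_dist y x.
  move=> lx ly; have [s [Fs sx sy us ls]] := pair _ _ lx ly.
  rewrite (@limit_distE s y x) // -?us; first exact: (ubC (Fframe Fs)).
  by rewrite (ubC (Fframe Fs)) // (lbC (Fframe Fs)) // us ls.
have dT x y z : pts limit x -> pts limit y -> pts limit z ->
    limit_dist x z <= limit_dist x y + limit_dist y z.
  move=> lx ly lz; have [s [Fs sx sy sz]] := above3 lx ly lz.
  (* The three pairs are decided one after the other; the earlier decisions survive in [w], where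
     the triangle inequality is read off. *)
  have [t [Ft st ut lt]] := limit_decided Fs sx sy.
  have [Pst _ _] := st.
  have [v [Fv tv uv lv]] := limit_decided Ft (Pst _ sy) (Pst _ sz).
  have [Ptv _ _] := tv.
  have [w [Fw vw uw lw]] := limit_decided Fv (Ptv _ (Pst _ sx)) (Ptv _ (Pst _ sz)).
  have [Pvw _ _] := vw.
  have inw p : pts s p -> pts w p by move=> sp; apply/Pvw/Ptv/Pst.
  have fw := Fframe Fw.
  have [e1 _] := finer_decided fw (finer_trans tv vw) (Pst _ sx) (Pst _ sy)
    (etrans ut (esym lt)).
  have [e2 _] := finer_decided fw vw (Ptv _ (Pst _ sy)) (Ptv _ (Pst _ sz))
    (etrans uv (esym lv)).
  by rewrite -uw -ut -uv -e1 -e2; apply: (ub_tri fw); exact: inw.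
split=> //= x y lx ly xy.
have [s [Fs sx sy <- _]] := pair _ _ lx ly.
exact: (ub_gt0 (Fframe Fs)).
Qed.

Lemma limit_edge x y q : edge limit x y q <-> exists2 s, F s & edge s x y q.
Proof.
split=> [[lx ly xy dq _]|[s Fs sxy]]; last first.
  exact: finer_edge limit_frame (limit_finer Fs) sxy.
have [s [Fs sx sy _]] := above3 lx ly lx.
have [t [Ft [st _ _] ut lt]] := limit_decided Fs sx sy.
exists t => //; split=> //; [exact: st|exact: st|by rewrite ut|by rewrite lt].
Qed.

Lemma limit_good : good M (edge limit).
Proof.
split.
- by move=> c x q /limit_edge[s Fs sx]; have [Ev _ _] := Fgood Fs; exact: Ev sx.
- move=> c x q /limit_edge[s Fs cx].
  have [_ Es _] := Fgood Fs; have [y [cy xy _]] := Es _ _ _ cx.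
  exists y; split; [by apply/limit_edge; exists s|by apply/limit_edge; exists s|].
  (* A further point of the sphere is compared with [x] and [y] in a frame above both witnesses. *)
  move=> z /limit_edge[t Ft cz]; have [v [Fv sv tv]] := Fdir Fs Ft.
  have fv := Fframe Fv; have [_ Vs _] := Fgood Fv.
  have [w [cw xw vw]] := Vs _ _ _ (finer_edge fv sv cx).
  have [yx|yw] := vw _ (finer_edge fv sv cy).
    by case: xy; rewrite yx.
  by rewrite yw; exact: vw (finer_edge fv tv cz).
- move=> c x q p /limit_edge[s Fs cx] Mp p0 qp.
  have [_ _ Ec] := Fgood Fs; have [y cy] := Ec _ _ _ _ cx Mp p0 qp.
  by exists y; apply/limit_edge; exists s.
Qed.

Lemma limit_full : full limit.
Proof.
split=> // c x q z /limit_edge[s Fs cx] [t Ft tz].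
have [sc _ _ _ _] := cx; have [v [Fv sv tv vc vz]] := above2 Fs Ft sc tz.
have [w [y [Fw zy]]] := Ffill Fv (finer_edge (Fframe Fv) sv cx) vz.
by exists y; apply/limit_edge; exists w.
Qed.

End limit.
End full_frames.

(** * Well-founded dependent choice and enumerations *)

Lemma wf_choice (T : Type) (lt : T -> T -> Prop) (S : Type) (s0 : S)
    (Q : T -> (T -> S) -> S -> Prop) : well_founded lt ->
  (forall i g g' s, (forall j, lt j i -> g j = g' j) -> Q i g s -> Q i g' s) ->
  (forall i g, (forall j, lt j i -> Q j g (g j)) -> exists s, Q i g s) ->
  exists f, forall i, Q i f (f i).
Proof.
move=> lt_wf Qloc Qex.
(* The values found below [i] are extended by [s0]; by [Qloc] the extension does not affect
   [Q i]. *)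
pose ext i (rec : forall j, lt j i -> S) j : S :=
  if pselect (lt j i) is left h then rec j h else s0.
pose next i (rec : forall j, lt j i -> S) : S :=
  xget (s0 : {classic S}) [set s | Q i (ext i rec) s].
pose f := Fix lt_wf (fun _ => S) next.
have fE i : f i = next i (fun j _ => f j).
  rewrite /f Fix_eq // => k g g' gg'; congr next.
  by apply/functional_extensionality_dep => j; apply/funext.
have extE i j : lt j i -> f j = ext i (fun j _ => f j) j.
  by rewrite /ext; case: pselect.
exists f; apply: (well_founded_ind lt_wf) => i IH.
have [s Qs] := Qex i f IH.
apply: (Qloc _ _ _ _ (fun j ji => esym (extE i j ji))).
rewrite fE; apply: (@xgetPex {classic S}).
by exists s; apply: Qloc Qs; exact: extE.
Qed.

Lemma countable_enum (T : Type) (P : set T) : countable P -> P !=set0 ->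
  exists a : nat -> T, (forall n, P (a n)) /\ forall x, P x -> exists n, a n = x.
Proof.
move=> /countable_injP[e e_inj] [x0 Px0].
(* Numbers that code no element are sent to [x0], so the enumeration may repeat. *)
exists (fun n => xget (x0 : {classic T}) [set x | P x /\ e x = n]); split.
  by move=> n; case: xgetP => [x _ []|].
move=> x Px; exists (e x); case: xgetP => [y _ [Py]|/(_ x)[]//].
by apply: e_inj; rewrite inE.
Qed.

(** * One round of countably many moves *)

Section completion.
Variables (R : realType) (M : set R) (U : pointedType).
Hypothesis Uunc : ~ countable [set: U].
Hypothesis M_ge0 : forall a, M a -> 0 <= a.
Hypothesis M_line : forall r, M r ->
  floppy (M `&` rat_line r) /\ is_monoid (M `&` rat_line r).

(** Step [n] performs the task coded by [n], provided that it refers to an earlier frame, and then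
    realises [m n] at [x0]. The limit of the resulting chain is the required frame. *)
Lemma completion (B : set R) (s0 : frame R U) (m : nat -> R) :
  (forall F, finite_set F -> F `<=` M -> `[0, +oo[ `<=` closure (ddot M `\`
     set_add (rat_scale (B `|` F)) (rat_scale (B `|` F)))) ->
  state M B s0 -> pts s0 !=set0 -> (forall n, M (m n)) ->
  exists t, [/\ is_frame t, countable (pts t), good M (edge t), full t &
    finer s0 t /\ forall n, m n <> 0 -> exists c x, edge t c x (m n)].
Proof.
move=> dense st0 [x0 sx0] Mm.
pose st := state M B (U := U).
(* Enumerations are fixed for all frames in advance, so that a task can name points of a frame built
   later by their indices. *)
have /choice[en enP] (s : frame R U) : exists a : nat -> U, st s -> finer s0 s ->
    (forall n, pts s (a n)) /\ forall x, pts s x -> exists n, a n = x.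
  have [[ss [fs0 _ _]]|n] := pselect (st s /\ finer s0 s); last first.
    by exists (fun=> x0) => ss fs0; case: n.
  have [_ sc _ _] := ss; have [|a aP] := countable_enum sc.
    by exists x0; exact: fs0.
  by exists a.
pose task (s t : frame R U) i j k := let x := en s i in let y := en s j in
  ub t x y = lb t x y /\ (x <> y -> exists w, edge t (en s k) w (ub t x y)).
(* The last component of the code makes every task recur infinitely often, hence
   after the frame it refers to. *)
pose Q (n : nat) (g : nat -> frame R U) s := [/\ st s, finer s0 s,
  forall k, (k < n)%N -> finer (g k) s,
  forall k i j l p : nat, unpickle n = Some (k, i, j, l, p) -> (k < n)%N -> task (g k) s i j l &
  m n <> 0 -> exists c x, edge s c x (m n)].
have [f fP] : exists f : nat -> frame R U, forall n, Q n f (f n).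
  apply: (wf_choice s0 (lt := fun i j => (i < j)%N)).
  - by move=> n; elim/ltn_ind: n => n IH; constructor=> k; exact: IH.
  - move=> n g g' s gg' [ss fs0 ch tk ed]; split=> //.
      by move=> k kn; rewrite -gg' //; exact: ch.
    by move=> k i j l p nE kn; rewrite -gg' //; exact: tk nE kn.
  - move=> n g gP.
    have [s [ss s0s gs]] : exists s, [/\ st s, finer s0 s &
        forall k, (k < n)%N -> finer (g k) s].
      case: n gP => [|n] gP; first by exists s0; split=> //; exact: finer_refl.
      have [gs g0 gch _ _] := gP n (ltnSn n).
      exists (g n); split=> // k; rewrite ltnS leq_eqVlt => /orP[/eqP->|/gch//].
      exact: finer_refl.
    have [t [tt st' tk]] : exists t, [/\ st t, finer s t & forall k i j l p : nat,
        unpickle n = Some (k, i, j, l, p) -> (k < n)%N -> task (g k) t i j l].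
      have [[[[[[k i] j] l] p]]|no] := pselect
        (exists p : nat * nat * nat * nat * nat, unpickle n = Some p); last first.
        exists s; split=> //; first exact: finer_refl.
        by move=> k i j l p nE; case: no; exists (k, i, j, l, p).
      move=> nE; have [kn|kn] := boolP (k < n)%N; last first.
        exists s; split=> //; first exact: finer_refl.
        by move=> k' i' j' l' p'; rewrite nE => -[<- _ _ _ _] k'n; rewrite k'n in kn.
      have [gk g0k _ _ _] := gP k kn; have [enk _] := enP _ gk g0k.
      have [Pgs _ _] := gs k kn.
      have [t [tt st' t1 t2]] := decide_fill Uunc M_ge0 M_line dense ss
        (Pgs _ (enk i)) (Pgs _ (enk j)) (Pgs _ (enk l)).
      exists t; split=> // k' i' j' l' p'; rewrite nE => -[<- <- <- <- _] _.
      by split.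
    have [m0|m0] := pselect (m n = 0).
      exists t; split=> //; first exact: finer_trans st'.
      by move=> k kn; exact: finer_trans (gs k kn) st'.
    have [Ps0 _ _] := finer_trans s0s st'.
    have [v [vv tv [y vy]]] := fill Uunc M_ge0 M_line tt (Ps0 _ sx0) (Mm n) m0.
    have [fv _ _ _] := vv; have [ft _ _ _] := tt.
    exists v; split=> //; [exact: finer_trans (finer_trans s0s st') tv| | |].
    + by move=> k kn; exact: finer_trans (finer_trans (gs k kn) st') tv.
    + move=> k i j l p nE kn; have [t1 t2] := tk _ _ _ _ _ nE kn.
      have [gk g0k _ _ _] := gP k kn; have [enk _] := enP _ gk g0k.
      have [Pgt _ _] := finer_trans (gs k kn) st'.
      have [e1 e2] := finer_decided fv tv (Pgt _ (enk i)) (Pgt _ (enk j)) t1.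
      split; rewrite e1 ?e2 //.
      by move=> /t2[w tw]; exists w; exact: finer_edge fv tv tw.
    + by exists x0, y.
have chain k n : (k <= n)%N -> finer (f k) (f n).
  rewrite leq_eqVlt => /orP[/eqP->|kn]; first exact: finer_refl.
  by have [_ _ ch _ _] := fP n; exact: ch.
have fframe n : is_frame (f n) by have [[]] := fP n.
pose F := range f.
have Fframe s : F s -> is_frame s by move=> [n _ <-].
have Fgood s : F s -> good M (edge s) by move=> [n _ <-]; have [[]] := fP n.
have Fdir s t : F s -> F t -> exists u, [/\ F u, finer s u & finer t u].
  move=> [i _ <-] [j _ <-]; exists (f (maxn i j)).
  by split; [exists (maxn i j)|exact/chain/leq_maxl|exact/chain/leq_maxr].
have later k x y z : pts (f k) x -> pts (f k) y -> pts (f k) z -> exists2 n, (k <= n)%N &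
    ub (f n) x y = lb (f n) x y /\ (x <> y -> exists w, edge (f n) z w (ub (f n) x y)).
  move=> kx ky kz; have [fk f0k _ _ _] := fP k; have [_ enk] := enP _ fk f0k.
  have [[i xi] [j yj] [l zl]] := And3 (enk _ kx) (enk _ ky) (enk _ kz).
  (* Codes are injective in [p], hence unbounded, and some code of this task comes after step
     [k]. *)
  have [p kp] : exists p : nat, (k < pickle (k, i, j, l, p))%N.
    have inj : injective (fun p : nat => pickle (k, i, j, l, p)).
      by move=> p q /(pcan_inj pickleK)[].
    by have [p ?] := injective_gtn inj k; exists p.
  exists (pickle (k, i, j, l, p)); first exact: ltnW.
  have [_ _ _ + _] := fP (pickle (k, i, j, l, p)).
  by move=> /(_ _ _ _ _ _ (pickleK _) kp); rewrite /task xi yj zl.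
have fF n : F (f n) by exists n.
have Fdecide s x y : F s -> pts s x -> pts s y ->
    exists t, [/\ F t, pts t x, pts t y & ub t x y = lb t x y].
  move=> [k _ <-] kx ky; have [n kn [uly _]] := later _ _ _ _ kx ky kx.
  by have [Pkn _ _] := chain _ _ kn; exists (f n); split=> //; exact: Pkn.
have Ffill s c x q z : F s -> edge s c x q -> pts s z ->
    exists t y, F t /\ edge t z y q.
  move=> [k _ <-] cx kz; have [kc kx ncx uq lq] := cx.
  have [n kn [_ /(_ ncx)[w zw]]] := later _ _ _ _ kc kx kz; exists (f n), w.
  have [e _] := finer_decided (fframe n) (chain _ _ kn) kc kx (etrans uq (esym lq)).
  by split=> //; rewrite -uq -e.
have lfin := limit_finer Fframe Fdir Fdecide.
have lfr := limit_frame Fframe Fdir Fdecide.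
exists (limit F); split=> //.
- by apply: bigcup_countable => [|s [n _ <-]]; [exact: sub_countable (card_image_le _ _) (countableP _)|have [[]] := fP n].
- exact: limit_good.
- exact: limit_full.
- split=> [|n m0]; first by have [_ s0f _ _ _] := fP 0; exact: finer_trans s0f (lfin _ _).
  have [_ _ _ _ /(_ m0)[c [x cx]]] := fP n; exists c, x.
  exact: finer_edge (lfin _ (fF n)) cx.
Qed.
End completion.

(** * From frames to metric spaces *)

Section realization.
Variables (R : realType) (U : choiceType) (L : frame R U).
Hypothesis fL : is_frame L.

Definition frame_points := {x : U | `[< pts L x >]}.
Let dist (x y : frame_points) : R := ub L (val x) (val y).

Let ptsP (x : frame_points) : pts L (val x).
Proof. by case: x => x /= /asboolP. Qed.

Let distxx x : dist x x = 0. Proof. exact: ubxx. Qed.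

Let dist_eq0 x y : dist x y = 0 -> x = y.
Proof.
move=> d0; apply: val_inj; apply: contrapT => xy.
by have := ub_gt0 fL (ptsP x) (ptsP y) xy; rewrite -/(dist x y) d0 ltxx.
Qed.

Let distC x y : dist x y = dist y x. Proof. exact: ubC. Qed.

Let dist_tri y x z : dist x z <= dist x y + dist y z.
Proof. exact: ub_tri. Qed.

HB.instance Definition _ := Choice.on frame_points.
HB.instance Definition _ :=
  @isMetric.Build R frame_points dist distxx dist_eq0 distC dist_tri.

(** Fullness carries a positive radius to the given centre, and goodness yields the antipodal pair
    there; for radius [0] both points are the centre. Asking for [M 0] only when [L] has a point
    admits the empty space. *)
Lemma full_banakh_space (M : set R) : good M (edge L) -> full L ->
  (forall c, pts L c -> M 0) ->
  (forall r, M r -> exists c x, [/\ pts L c, pts L x & ub L c x = r]) ->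
  exists X : metricType R, banakh_space X /\ distances X = M.
Proof.
move=> [Ev Es _] [Ldec Lfill] M0 Mex; exists frame_points.
have edgeP (x y : frame_points) : val x <> val y -> edge L (val x) (val y) (dist x y).
  by move=> xy; split=> //; rewrite -Ldec.
have pt x : pts L x -> exists u : frame_points, val u = x.
  by move=> /asboolP Lx; exists (Sub x Lx); rewrite SubK.
have mE (x y : frame_points) : mdist x y = dist x y by [].
split; last first.
  apply/seteqP; split=> [_ [x _ [y _ <-]]|r /Mex[c [x [Lc Lx <-]]]].
    have [xy|xy] := pselect (val x = val y).
      by rewrite mE /dist xy ubxx //; exact: M0 (ptsP y).
    by have [] := Ev _ _ _ (edgeP _ _ xy).
  have [[c' <-] [x' <-]] := (pt _ Lc, pt _ Lx).
  by exists c' => //; exists x'.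
move=> c r [x _ [y _ <-]].
have [xy|xy] := pselect (x = y).
  exists c, c; rewrite xy !mE !distxx mulr0; split=> //.
  apply/seteqP; split=> z; rewrite /metric_sphere /= mE; first by move/dist_eq0; left.
  by move=> [] ->; rewrite distxx.
have vxy : val x <> val y by move/val_inj.
have [u cu] := Lfill _ _ _ _ (edgeP _ _ vxy) (ptsP c).
have [v [cv uv only]] := Es _ _ _ cu.
have [_ /pt[u' uE] _ _ _] := cu; have [_ /pt[v' vE] _ _ _] := cv.
rewrite -uE -vE in cu cv uv only.
exists u', v'; split; last by case: uv.
apply/seteqP; split=> [z|z]; rewrite /metric_sphere /= !mE.
  rewrite distC => cz; have [cz0|ncz] := pselect (val c = val z).
    move: cz; rewrite /dist cz0 ubxx // => /esym/dist_eq0 xy0.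
    by case: xy.
  by have := edgeP _ _ ncz; rewrite cz => /only[/val_inj->|/val_inj->]; [left|right].
by case=> ->; rewrite distC; [case: cu|case: cv].
Qed.
End realization.

(** * A well-order with countable initial segments *)

Lemma omega1_order (T : Type) (M : set T) : (M #<= omega1)%card ->
  exists lt : T -> T -> Prop, [/\ well_founded lt,
    forall a b, M a -> M b -> [\/ a = b, lt a b | lt b a] &
    forall a, M a -> countable [set b | M b /\ lt b a]].
Proof.
move=> Mw; have [le le_wo] := wochoice.well_ordering_principle (set nat).
pose lt x y := ~~ le y x.
have min_ex (P : set (set nat)) : P !=set0 -> exists2 x, P x & forall y, lt y x -> ~ P y.
  move=> [p Pp]; have [|x [[/asboolP Px xmin] _]] := le_wo (fun x => `[< P x >]).
    by exists p; apply/asboolP.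
  by exists x => // y /negP ltyx Py; apply/ltyx/xmin/asboolP.
have lt_wf : well_founded lt.
  move=> x; apply: contrapT => nx.
  have [y ny ymin] := min_ex [set z | ~ Acc lt z] (ex_intro _ x nx).
  by apply: ny; split=> z /ymin /contrapT.
have lt_total x y : [\/ x = y, lt x y | lt y x].
  have [xy|] := boolP (le x y); last by constructor 3.
  have [yx|] := boolP (le y x); last by constructor 2.
  constructor 1.
  by apply: (wochoice.wo_chain_antisymmetric (C := predT) (wochoice.withinW le_wo));
    rewrite ?xy ?yx.
(* A well-order of [set nat] is cut at its first point with uncountably many predecessors, if there
   is one. Minimality of [omega1] then embeds [M] into [W], and the order is pulled back. *)
have [W Wunc Wseg] : exists2 W : set (set nat), ~ countable W &
    forall x, W x -> countable [set y | lt y x].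
  have [[x xunc]|nunc] := pselect (exists x, ~ countable [set y | lt y x]).
    have [w wunc wmin] := min_ex [set z | ~ countable [set y | lt y z]]
      (ex_intro _ x xunc).
    by exists [set y | lt y w] => // z /wmin /contrapT.
  exists setT; first exact: uncountable_set_nat.
  by move=> x _; apply: contrapT => xunc; apply: nunc; exists x.
have := card_le_trans Mw (omega1P.2 _ _ Wunc).
move=> /pcard_leP/injfunPex[h hW h_inj]; exists (fun a b => lt (h a) (h b)); split.
- move=> a; have [w wE] : exists w, h a = w by exists (h a).
  by elim: (lt_wf w) a wE => z _ IH a az; constructor=> b ba; apply: IH erefl; rewrite -az.
- move=> a b Ma Mb; have [hab|ab|ba] := lt_total (h a) (h b).
  + by constructor 1; apply: h_inj; rewrite ?inE.
  + by constructor 2.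
  + by constructor 3.
- move=> a Ma; apply: sub_countable (Wseg _ (hW _ Ma)).
  apply/pcard_leP/injfunPex; exists h; first by move=> b [].
  by move=> b c /set_mem[Mb _] /set_mem[Mc _]; apply: h_inj; rewrite inE.
Qed.

Lemma one_point_frame (R : realType) (U : choiceType) (x : U) :
  let s := Frame [set x] (fun _ _ => 0 : R) (fun _ _ => 0) in
  is_frame s /\ forall u v q, ~ edge s u v q.
Proof.
split; last by move=> u v q [-> ->].
by split=> // [_ _ -> -> //|? ? ? _ _ _|? ? ? _ _ _]; rewrite addr0.
Qed.

(** * The countable and the uncountable case *)

Section main.
Variables (R : realType) (M : set R).
Hypothesis M_pos : M `<=` `[0, +oo[.
Hypothesis M_floppy : forall r, M r ->
  floppy (M `&` rat_line r) /\ is_monoid (M `&` rat_line r).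
Hypothesis M_dense : forall B : set R, B `<=` M -> card_lt B M ->
     `[0, +oo[ `<=` closure (ddot M `\` set_add (rat_scale B) (rat_scale B)).
Let U : pointedType := set nat.
Let Uunc : ~ countable [set: U]. Proof. exact: uncountable_set_nat. Qed.
Let M_ge0 a : M a -> 0 <= a. Proof. by move=> /M_pos; rewrite /= in_itv /= andbT. Qed.

Let M0 r : M r -> M 0.
Proof. by move=> /M_floppy[_ [[]]]. Qed.

(** Density with [B] empty makes [ddot M] unbounded, whereas a finite [M] has no element within
    distance [1] of a large [b]. Finite subsets are therefore smaller than [M]. *)
Lemma M_infinite r : M r -> ~ finite_set M.
Proof.
move=> Mr /finite_seqP[l Ml].
have [b b0 lb] : exists2 b : R, 0 <= b & forall a, a \in l -> a + 1 <= b.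
  elim: l {Ml} => [|a l [b b0 lb]]; first by exists 0.
  exists (Num.max (a + 1) b); first by rewrite le_max b0 orbT.
  move=> c; rewrite inE le_max => /orP[/eqP->|/lb->]; rewrite ?lexx ?orbT //.
have lt0M : card_lt (set0 : set R) M.
  by split=> // /card_le0P M0'; rewrite M0' in Mr.
have b_in : `[0, +oo[%classic b by rewrite /= in_itv /= andbT.
have [a [[[[+ _] _] _]]] := M_dense (@sub0set _ M) lt0M b_in (nbhsx_ballx b 1 ltr01).
rewrite Ml /= => /lb ab; rewrite /ball /= ltr_norml => /andP[_]; lra.
Qed.

Let pt : frame R U := Frame [set point] (fun _ _ => 0) (fun _ _ => 0).

Lemma pt_state B : state M B pt.
Proof.
have [fp pe] := one_point_frame R (point : U).
split=> //; first exact: countable1.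
  by split=> c x q; [move/pe|move/pe|move=> p /pe].
by exists set0; split=> // u v q /pe.
Qed.

Lemma banakh_of_frame (L : frame R U) : is_frame L -> good M (edge L) -> full L ->
  pts L point -> (exists r, M r) ->
  (forall r, M r -> r <> 0 -> exists c x, edge L c x r) ->
  exists X : metricType R, banakh_space X /\ distances X = M.
Proof.
move=> fL gL ful Lp [r0 Mr0] ed; apply: (full_banakh_space fL gL ful).
  by move=> _ _; exact: M0 Mr0.
move=> r Mr; have [->|r_neq0] := pselect (r = 0).
  by exists point, point; rewrite (ubxx fL).
by have [c [x [Lc Lx _ uq _]]] := ed _ Mr r_neq0; exists c, x.
Qed.

(** One round from a single point suffices, with [B] empty and [m] enumerating [M]: the sets [F] met
    on the way are finite, hence smaller than [M]. *)
Lemma countable_case : countable M -> M !=set0 ->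
  exists X : metricType R, banakh_space X /\ distances X = M.
Proof.
move=> Mc M_n0; have [m [Mm mM]] := countable_enum Mc M_n0.
have [r Mr] := M_n0.
have [||t [ft _ gt ful [[Pt _ _] tm]]] := completion Uunc M_ge0 M_floppy _ (pt_state set0) _ Mm.
- move=> F Ffin FM; rewrite set0U; apply: M_dense => //; split.
    exact: subset_card_le.
  by move=> MF; apply: (M_infinite Mr); apply: card_le_finite MF Ffin.
- by exists point.
apply: banakh_of_frame ft gt ful _ M_n0 _; first exact: Pt.
by move=> q /mM[n <-]; exact: tm.
Qed.

(** Stage [i] completes the limit of the earlier stages and realises the distance [i]. Every stage
    is countable, so the distances used before it form a set smaller than [M]. *)
Lemma uncountable_case : ~ countable M -> (M #<= omega1)%card ->
  exists X : metricType R, banakh_space X /\ distances X = M.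
Proof.
move=> Munc /omega1_order[lt [lt_wf lt_total lt_count]].
have M_n0 : M !=set0.
  by apply/set0P/eqP => ME; apply: Munc; rewrite ME; exact: countable0.
(* All reals serve as indices; those outside [M] carry no condition. *)
pose Q i (g : R -> frame R U) s := M i -> [/\ is_frame s /\ good M (edge s),
  countable (pts s), full s, finer pt s &
  (forall j, M j -> lt j i -> finer (g j) s) /\
  (i <> 0 -> exists c x, edge s c x i)].
(* This serves both the stages below a given one and the whole of [M]. Adding [pt] keeps the family
   nonempty at the least stage. *)
have lim_hyps (J : set R) (g : R -> frame R U) : J `<=` M ->
    (forall j, J j -> Q j g (g j)) ->
    let F := [set pt] `|` g @` J in
    [/\ forall s, F s -> is_frame s, forall s, F s -> good M (edge s),
      forall s t, F s -> F t -> exists u, [/\ F u, finer s u & finer t u],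
      forall s x y, F s -> pts s x -> pts s y ->
        exists t, [/\ F t, pts t x, pts t y & ub t x y = lb t x y] &
      forall s c x q z, F s -> edge s c x q -> pts s z ->
        exists t y, F t /\ edge t z y q].
  move=> JM gQ F.
  have [fpt ptE] := one_point_frame R (point : U).
  have Fg j : J j -> F (g j) by move=> Jj; right; exists j.
  have gframe j : J j -> is_frame (g j) /\ good M (edge (g j)).
    by move=> Jj; have [] := gQ j Jj (JM _ Jj).
  have gfull j : J j -> full (g j) by move=> Jj; have [] := gQ j Jj (JM _ Jj).
  have ptg j : J j -> finer pt (g j) by move=> Jj; have [] := gQ j Jj (JM _ Jj).
  have gg j k : J j -> J k -> lt j k -> finer (g j) (g k).
    by move=> Jj Jk jk; have [_ _ _ _ [+ _]] := gQ k Jk (JM _ Jk); apply=> //; exact: JM.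
  split.
  - by move=> s [->|[j /gframe[] + _ <-]].
  - move=> s [->|[j /gframe[] _ + <-]] //.
    by split=> c x q; [move/ptE|move/ptE|move=> p /ptE].
  - move=> s t [->|[j Jj <-]] [->|[k Jk <-]].
    + by exists pt; split; [left|exact: finer_refl|exact: finer_refl].
    + by exists (g k); split; [exact: Fg|exact: ptg|exact: finer_refl].
    + by exists (g j); split; [exact: Fg|exact: finer_refl|exact: ptg].
    + have [<-|jk|kj] := lt_total _ _ (JM _ Jj) (JM _ Jk).
      * by exists (g j); split; [exact: Fg|exact: finer_refl|exact: finer_refl].
      * by exists (g k); split; [exact: Fg|exact: gg|exact: finer_refl].
      * by exists (g j); split; [exact: Fg|exact: finer_refl|exact: gg].
  - move=> s x y [->|[j Jj <-]] sx sy; first by exists pt; split=> //; left.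
    by exists (g j); split=> //; [exact: Fg|have [+ _] := gfull _ Jj; exact].
  - move=> s c x q z [->|[j Jj <-]]; first by move/ptE.
    move=> cx jz; have [_ fil] := gfull _ Jj.
    by have [y zy] := fil _ _ _ _ cx jz; exists (g j), y; split; [exact: Fg|].
have [f fP] : exists f : R -> frame R U, forall i, Q i f (f i).
  apply: (wf_choice pt lt_wf).
    move=> i g g' s gg' Qi Mi; have [? ? ? ? [sg si]] := Qi Mi; split=> //.
    by split=> // j Mj ji; rewrite -gg' //; exact: sg.
  move=> i g gQ; have [Mi|nMi] := pselect (M i); last by exists pt.
  pose J := [set j | M j /\ lt j i].
  have JM : J `<=` M by move=> j [].
  have [Ff Fg Fd Fu Fl] := lim_hyps J g JM (fun j Jj => gQ j Jj.2).
  set F := _ `|` _ in Ff Fg Fd Fu Fl.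
  pose L := limit F.
  have Fpt : F pt by left.
  have ptL : finer pt L by exact: limit_finer.
  pose B := [set q | exists c x, edge L c x q].
  have gL : good M (edge L) by exact: limit_good.
  have BM : B `<=` M by move=> q [c [x cx]]; have [Ev _ _] := gL; have [] := Ev _ _ _ cx.
  have Lc : countable (pts L).
    apply: bigcup_countable => [|s [->|[j Jj <-]]]; last 2 first.
    - exact: countable1.
    - by have [] := gQ j Jj.2 (JM _ Jj).
    apply: countable_setU; first exact: countable1.
    exact: sub_countable (card_image_le _ _) (lt_count _ Mi).
  have Bc : countable B.
    apply: (@sub_countable _ _ _ ((fun p => ub L p.1 p.2) @` (pts L `*` pts L))).
      apply: subset_card_le => q [c [x [Lc' Lx _ <- _]]]; by exists (c, x).
    exact: sub_countable (card_image_le _ _) (countableX Lc Lc).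
  have dense F' : finite_set F' -> F' `<=` M -> `[0, +oo[ `<=` closure (ddot M `\`
     set_add (rat_scale (B `|` F')) (rat_scale (B `|` F'))).
    move=> F'fin F'M; have BF : B `|` F' `<=` M by move=> q [/BM|/F'M].
    apply: M_dense => //; split; first exact: subset_card_le.
    move=> MBF; apply: Munc; apply: sub_countable MBF _.
    by apply: countable_setU => //; exact: finite_set_countable.
  have stL : state M B L.
    split=> //; first exact: limit_frame.
    exists set0; split=> // u v q uv; apply: rat_scale_mem; left.
    by exists u, v.
  (* The constant sequence makes the round realise [i]. *)
  have [|t [ft tc gt ful [Lt ti]]] := completion Uunc M_ge0 M_floppy dense stL _ (fun _ : nat => Mi).
    by exists point; have [Pt _ _] := ptL; exact: Pt.
  exists t => _; split=> //; first exact: finer_trans Lt.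
  split=> [j Mj ji|i0]; last by have [] := ti 0%N i0; eauto.
  by apply: finer_trans Lt; apply: limit_finer => //; right; exists j.
have [Ff Fg Fd Fu Fl] := lim_hyps M f (@subset_refl _ M) (fun j _ => fP j).
set F := _ `|` _ in Ff Fg Fd Fu Fl.
have Fpt : F pt by left.
have lfin s : F s -> finer s (limit F) by exact: limit_finer.
apply: (@banakh_of_frame (limit F)) => //.
- exact: limit_frame.
- exact: limit_good.
- exact: limit_full.
- by have [Pt _ _] := lfin _ Fpt; exact: Pt.
- move=> q Mq q0; have [_ _ _ _ [_ /(_ q0)[c [x cx]]]] := fP q Mq.
  exists c, x; apply: finer_edge cx; first exact: limit_frame.
  by apply: lfin; right; exists q.
Qed.

End main.

Theorem theorem16p9 (R : realType) (M : set R)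
  (M_ge0 : M `<=` `[0, +oo[)
  (M_omega1 : (M #<= omega1)%card)
  (M_floppy : forall r, M r ->
     floppy (M `&` rat_line r) /\ is_monoid (M `&` rat_line r))
  (M_dense : forall B : set R, B `<=` M -> card_lt B M ->
     `[0, +oo[ `<=`
       closure (ddot M `\` set_add (rat_scale B) (rat_scale B))) :
  exists X : metricType R, banakh_space X /\ distances X = M.
Proof.
have [Mc|Munc] := pselect (countable M); last exact: uncountable_case.
have [M_n0|ME] := pselect (M !=set0); first exact: countable_case.
(* For empty [M] the empty space is a solution. *)
pose L : frame R (set nat) := Frame set0 (fun _ _ => 0) (fun _ _ => 0).
have noE c x q : ~ edge L c x q by case.
apply: (@full_banakh_space _ _ L); [by split| | |by []|].
- by split=> c x q; [move/noE|move/noE|move=> p /noE].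
- by split=> // c x q z /noE.
- by move=> r Mr; case: ME; exists r.
Qed.
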